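(* Each of the following $16$ step sets $\mathcal S\subset\mathbb Z^2$ has an infinite orbit: \begin{enumerate} \item $\{(-2,1),(0,1),(1,-2)\}$; \item $\{(-2,1),(1,-2),(1,1)\}$; \item $\{(-2,1),(1,-1),(1,0)\}$; \item $\{(-2,1),(1,-1),(1,1)\}$; \item $\{(-2,-1),(1,-1),(1,1)\}$; \item $\{(-2,-1),(1,0),(1,1)\}$; \item $\{(-2,1),(-1,1),(0,1),(1,-1)\}$; \item $\{(-2,-1),(-1,-1),(0,-1),(1,1)\}$; \item $\{(-2,-2),(-2,0),(1,0),(1,1)\}$; \item $\{(-2,-2),(-2,0),(-1,-1),(-1,0),(1,0),(1,1)\}$; \item $\{(-2,-1),(-1,-1),(0,-1),(0,1),(1,-1),(1,1)\}$; \item $\{(-2,1),(-1,1),(0,-1),(0,1),(1,-1),(1,1)\}$; \item $\{(-2,1),(-1,0),(0,-1),(0,1),(1,-2),(1,0)\}$; \item $\{(-2,1),(-1,0),(0,1),(1,-2),(1,-1),(1,1)\}$; \item $\{(-2,-1),(-1,1),(0,1),(1,-2),(1,0),(1,1)\}$; \item $\{(-2,1),(-1,0),(-1,1),(0,-1),(0,1),(1,-2),(1,-1),(1,0),(1,1)\}$. \end{enumerate}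
   Context: For a finite $\mathcal S\subset\mathbb Z^2$, the step polynomial is $S(x,y)=\sum_{(k,\ell)\in\mathcal S}x^ky^\ell$. Let $\overline{\mathbb K}$ be an algebraic closure of $\mathbb C(x,y)$. Two distinct pairs $\mathbf u,\mathbf v\in(\overline{\mathbb K}\setminus\{0\})^2$ are adjacent if $S(\mathbf u)=S(\mathbf v)$ and they differ in exactly one coordinate. The orbit of $\mathcal S$ is the equivalence class of $(x,y)$ under the reflexive and transitive closure of adjacency. *)

(* Defs.v *)
From Stdlib Require Import Relation_Operators.
From mathcomp Require Import all_boot all_order all_algebra.
From mathcomp Require Import finmap.
From mathcomp Require Import boolp classical_sets cardinality reals.
From mathcomp Require Import complex.

Set Implicit Arguments.
Unset Strict Implicit.
Unset Printing Implicit Defensive.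

Import GRing.Theory.

Local Open Scope fset_scope.
Local Open Scope ring_scope.

(* C(x,y), as the fraction field of C[x,y] = C[y][x]; the outer polynomial
   variable is x and the inner one is y. *)
Definition ratfun2 (R : realType) : fieldType := {fraction {poly {poly R[i]}}}.

Definition varx (R : realType) : ratfun2 R := tofrac ('X : {poly {poly R[i]}}).
Definition vary (R : realType) : ratfun2 R := tofrac ('Y : {poly {poly R[i]}}).

(* Algebraic closedness is carried by the type of K, so only algebraicity of the
   extension remains to be required. *)
Definition algebraic_closure (F : fieldType) (K : closedFieldType)
    (iota : {rmorphism F -> K}) : Prop :=
  forall z : K, algebraicOver iota z.

Definition step_poly (K : fieldType) (S : {fset int * int}) (u : K * K) : K :=
  \sum_(s <- S) u.1 ^ s.1 * u.2 ^ s.2.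

Definition adjacent (K : fieldType) (S : {fset int * int}) (u v : K * K) : Prop :=
  [/\ [&& u.1 != 0, u.2 != 0, v.1 != 0 & v.2 != 0],
      u != v,
      step_poly S u = step_poly S v &
      (u.1 != v.1) (+) (u.2 != v.2)].

(* Adjacency is symmetric, so its reflexive and transitive closure is an
   equivalence relation on pairs of nonzero elements. *)
Definition step_orbit (R : realType) (K : closedFieldType)
    (iota : {rmorphism ratfun2 R -> K}) (S : {fset int * int}) : set (K * K) :=
  [set u | clos_refl_trans (K * K) (adjacent S)
             (iota (varx R), iota (vary R)) u]%classic.

Definition exceptional_step_sets : seq {fset int * int} :=
  ([:: [fset (-2, 1); (0, 1); (1, -2)];
       [fset (-2, 1); (1, -2); (1, 1)];
       [fset (-2, 1); (1, -1); (1, 0)];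
       [fset (-2, 1); (1, -1); (1, 1)];
       [fset (-2, -1); (1, -1); (1, 1)];
       [fset (-2, -1); (1, 0); (1, 1)];
       [fset (-2, 1); (-1, 1); (0, 1); (1, -1)];
       [fset (-2, -1); (-1, -1); (0, -1); (1, 1)];
       [fset (-2, -2); (-2, 0); (1, 0); (1, 1)];
       [fset (-2, -2); (-2, 0); (-1, -1); (-1, 0); (1, 0); (1, 1)];
       [fset (-2, -1); (-1, -1); (0, -1); (0, 1); (1, -1); (1, 1)];
       [fset (-2, 1); (-1, 1); (0, -1); (0, 1); (1, -1); (1, 1)];
       [fset (-2, 1); (-1, 0); (0, -1); (0, 1); (1, -2); (1, 0)];
       [fset (-2, 1); (-1, 0); (0, 1); (1, -2); (1, -1); (1, 1)];
       [fset (-2, -1); (-1, 1); (0, 1); (1, -2); (1, 0); (1, 1)];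
       [fset (-2, 1); (-1, 0); (-1, 1); (0, -1); (0, 1); (1, -2); (1, -1);
             (1, 0); (1, 1)]])%Z.

(* Main.v *)
Require Import Defs.
From mathcomp Require Import all_boot all_order all_algebra.
From mathcomp Require Import finmap.
From mathcomp Require Import boolp classical_sets cardinality reals.
From mathcomp Require Import complex.
From Stdlib Require Import Relation_Operators.
From mathcomp Require Import ring zify.
From HB Require Import structures.

(** All points of the orbit of (x, y) lie on the curve S = t, where t = S(x, y)
    is fixed.  The orbit is followed near a boundary point of this curve: choose
    a valuation ring O of K, with maximal ideal M and residue characteristic 0,
    for which x and y are small, large, or generic units as one likes.  Such
    rings exist because x and y are algebraically independent ([place_small],
    [place_refine], resting on the maximality argument [place_above]).  As K is
    algebraically closed, Hensel's lemma [hensel] produces neighbours whose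
    leading behaviour is prescribed, so that a chosen walk in the orbit can be
    tracked up to elements of M.  Three mechanisms show that it never closes up.

    Contraction (12 step sets).  If one monomial of S dominates at (x, y) and
    another one can dominate at (x, y'), then y' is a monomial in x, y up to a
    factor 1 + M ([vert_move], [horiz_move]).  On the level of valuations the
    point moves on the tropical curve of S - t, along vertical and horizontal
    lines.  When two edges leave a vertex of that curve into the same open
    quadrant, bouncing between them contracts towards the vertex without
    reaching it ([contracting_vertex]); for one step set a loop through four edges does
    the same ([contracting_cycle]).  The valuations of x are then strictly
    monotone along the walk.

    Drift (2 step sets).  For S = (1 + x) (y + (1 + x^-2) / y) and y large, two
    branches of the curve pass through x = 0.  Going once around them returns y
    to y + 2 (1 + x0) r up to M, where r^2 x0 = 1, a translation by a unit of O
    ([drift_infinite]).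

    Translation (2 step sets).  For S = x (1 + y) + x^-2 (1 + y^-2), possibly
    with x^-1 (1 + y^-1) added, and x much larger than every power of y, itself
    large, one walk of three moves takes y to -y - 3 and another one takes y to
    -y, up to M ([far_shift], [far_reflect]).  Together they translate y by 3
    ([translation_infinite]).  In both translation cases the residue field has
    characteristic 0, so that the values of y are distinct modulo M.

    Inverting y maps step sets to step sets and orbits to orbits
    ([infinite_mirror]), which halves the work. *)

Set Implicit Arguments.
Unset Strict Implicit.
Unset Printing Implicit Defensive.

Import Order.TTheory GRing.Theory Num.Theory.
Local Open Scope ring_scope.

(** * Existence of valuation rings *)

(** A place of K is given by its valuation ring; the last field says that the
    residue field has characteristic 0. *)
Record place (K : fieldType) := Place {
  integral : {pred K};
  integral_subring : subring_closed integral;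
  integral_total : forall z, (z \in integral) || (z^-1 \in integral);
  integral_natV : forall n, (n.+1%:R != 0 :> K) && (n.+1%:R^-1 \in integral) }.

HB.instance Definition _ (K : fieldType) (v : place K) :=
  GRing.isSubringClosed.Build K (integral v) (@integral_subring K v).

(** The maximal ideal; 0 is singled out because its inverse is 0 by convention. *)
Definition infinitesimal (K : fieldType) (v : place K) : {pred K} :=
  [pred z | (z == 0) || (z^-1 \notin integral v)].

(** A subring B that is maximal among those containing s but not s^-1 is a
    valuation ring: adjoining any z outside B must create s^-1. *)
Section Maximal.
Variables (K : fieldType) (B : subringClosed K) (s : K).
Hypotheses (sB : s \in B) (sVB : s^-1 \notin B).
Hypothesis Bmax : forall z, z \notin B -> exists2 p, p \is a polyOver B & s^-1 = p.[z].

Lemma maximal_neq0 : s != 0.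
Proof. by apply: contraNneq sVB => ->; rewrite invr0 rpred0. Qed.

(** If u = 1 - s b were not invertible in B, then s^-1 would be a polynomial in
    u^-1; clearing denominators, s^-1 u^n is in B for some n, and u^n = 1 - s c
    puts s^-1 itself in B. *)
Lemma maximal_unit b : b \in B -> (1 - s * b)^-1 \in B.
Proof.
move=> bB; set u := 1 - s * b; apply/negPn/negP => uB.
have [p pB wE] := Bmax uB.
have s0 := maximal_neq0.
have u0 : u != 0 by apply: contraNneq uB => ->; rewrite invr0 rpred0.
have uuB : u \in B by rewrite rpredB ?rpred1 ?rpredM.
have [n pu] : exists n, s^-1 * u ^+ n \in B.
  exists (size p); rewrite wE horner_coef mulr_suml rpred_sum // => i _.
  rewrite -mulrA exprVn mulrC [_ * u ^+ _]mulrC -exprB ?unitfE // 1?ltnW // mulrC rpredM ?rpredX //.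
  exact: (polyOverP pB).
have [c cB uE] : exists2 c, c \in B & u ^+ n = 1 - s * c.
  elim: n {pu} => [|n [c cB uE]]; first by exists 0; rewrite ?rpred0 ?mulr0 ?subr0.
  exists (b + c - s * b * c); first by rewrite rpredB ?rpredD ?rpredM.
  by rewrite exprS uE /u; ring.
have wE' : s^-1 = s^-1 * u ^+ n + c by rewrite uE; field.
by move/negP: sVB; apply; rewrite wE' rpredD.
Qed.

Definition inverse_relation (z : K) n :=
  exists p, [/\ p \is a polyOver B, (size p <= n.+1)%N & s * p.[z] = 1].

Lemma inverse_relation0 z : ~ inverse_relation z 0.
Proof.
case=> p [pB sp E]; move/negP: sVB; apply.
have pE := size1_polyC sp.
have -> : s^-1 = p`_0 by rewrite pE hornerC in E; apply: (mulfI maximal_neq0); rewrite E divff // maximal_neq0.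
exact: (polyOverP pB).
Qed.

(** The relation in z^-1, divided by the unit 1 - s q_0 and multiplied by
    z^(n+1), expresses z^(n+1) through lower powers of z; this eliminates the
    leading term of the relation in z. *)
Lemma inverse_relation_lower z n m : z != 0 -> (m <= n.+1)%N ->
  inverse_relation z n.+1 -> inverse_relation z^-1 m -> inverse_relation z n.
Proof.
move=> z0 mn [p [pB sp pE]] [q [qB sq qE]].
set u := 1 - s * q`_0.
have q0B i : q`_i \in B by apply: (polyOverP qB).
have p0B i : p`_i \in B by apply: (polyOverP pB).
have uV : u^-1 \in B by apply: maximal_unit.
pose g := \sum_(i < m) q`_i.+1 *: 'X^(n - i).
have gE : u * z ^+ n.+1 = s * g.[z].
  rewrite /g horner_sum /u -qE (horner_coef_wide _ sq) big_ord_recl /=.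
  rewrite expr0 mulr1 mulrDr addrC addKr -mulrA mulr_suml; congr (_ * _).
  apply: eq_bigr => i _; rewrite hornerZ hornerXn -mulrA; congr (_ * _).
  rewrite /bump /= add1n exprVn mulrC -exprB ?unitfE //.
  exact: leq_trans (ltn_ord i) mn.
have u0 : u != 0.
  apply/eqP => u0; case: (@inverse_relation0 0); exists (q`_0)%:P.
  rewrite polyOverC q0B size_polyC hornerC; split => //; first by case: eqP.
  by apply/esym/eqP; rewrite -subr_eq0 -/u u0.
pose p' := \poly_(i < n.+1) p`_i.
exists (p' + (s * p`_n.+1 / u) *: g); split.
- rewrite rpredD //; first by apply/polyOver_poly => i _.
  rewrite polyOverZ ?rpredM // rpred_sum // => i _.
  by rewrite polyOverZ // polyOverXn.
- rewrite (leq_trans (size_polyD _ _)) // geq_max size_poly /=.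
  rewrite (leq_trans (size_scale_leq _ _)) // (leq_trans (size_sum _ _ _)) //.
  apply/bigmax_leqP => i _; rewrite (leq_trans (size_scale_leq _ _)) //.
  by rewrite size_polyXn ltnS leq_subr.
- rewrite -pE (horner_coef_wide _ sp) big_ord_recr /= hornerD hornerZ.
  have -> : p'.[z] = \sum_(i < n.+1) p`_i * z ^+ i by rewrite horner_poly.
  rewrite !mulrDr; congr (_ + _); rewrite -[p`_n.+1 * _](mulKf u0).
  by rewrite [u * (_ * _)]mulrCA gE; field.
Qed.

Lemma maximal_total z : (z \in B) || (z^-1 \in B).
Proof.
apply/negPn/negP; rewrite negb_or => /andP[zB zVB].
have z0 : z != 0 by apply: contraNneq zB => ->; rewrite rpred0.
have R y : y \notin B -> exists n, inverse_relation y n.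
  move=> yB; have [p pB E] := Bmax yB; exists (size p), p; split=> //.
  by rewrite -E divff ?maximal_neq0.
have [n Rn] := R _ zB; have [m Rm] := R _ zVB.
(* Infinite descent on the sum of the degrees. *)
have : (n + m <= n + m)%N by [].
move: {2}(n + m)%N => N.
elim: N n m Rn Rm => [|N IH] n m Rn Rm.
  by rewrite leqn0 addn_eq0 => /andP[/eqP n0 _]; rewrite n0 in Rn; case: (inverse_relation0 Rn).
case: n Rn => [|n] Rn; first by case: (inverse_relation0 Rn).
case: m Rm => [|m] Rm; first by case: (inverse_relation0 Rm).
case: (leqP m n) => mn nmN.
  by apply: (IH n m.+1) => //; apply: inverse_relation_lower Rn Rm.
apply: (IH n.+1 m) => //; last by move: nmN; rewrite addnS.
apply: (inverse_relation_lower (m := n.+1)) => //; rewrite ?invr_eq0 ?invrK //.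
exact: ltnW.
Qed.
End Maximal.

(** Zorn's lemma gives a subring above A that is maximal without s^-1.  Chains
    of arbitrary sets B are used, each standing for B together with A, so that
    the empty chain has a bound as well. *)
Lemma place_above (K : fieldType) (A : subringClosed K) (s : K) :
    (forall n, (n.+1%:R != 0 :> K) && (n.+1%:R^-1 \in A)) -> s \in A -> s^-1 \notin A ->
  exists2 v : place K, {subset A <= integral v} & s^-1 \notin integral v.
Proof.
move=> natA sA sVA.
pose ext (B : set K) : set K := (B `|` [set a | a \in A])%classic.
pose P (B : set K) := [/\ forall a b, ext B a -> ext B b -> ext B (a - b),
  forall a b, ext B a -> ext B b -> ext B (a * b) & ~ ext B s^-1].
have [|B [[BB BM sVB] Bmax]] := @Zorn_bigcup K P.
  move=> F FP Ftot.
  have cover a b : ext (\bigcup_(X in F) X)%classic a ->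
      ext (\bigcup_(X in F) X)%classic b ->
      exists B, [/\ P B, ext B a, ext B b &
        forall c, ext B c -> ext (\bigcup_(X in F) X)%classic c].
    have sub B : F B -> forall c, ext B c -> ext (\bigcup_(X in F) X)%classic c.
      by move=> FB c [Bc|Ac]; [left; exists B|right].
    have P0 : P set0.
      by split=> [a1 b1 [//|a1A] [//|b1A]|a1 b1 [//|a1A] [//|b1A]|[//|]];
         [right; rewrite /= rpredB|right; rewrite /= rpredM|apply/negP].
    move=> [[B FB Ba]|Aa] [[C FC Cb]|Ab].
    - have [BC|CB] := Ftot _ _ FB FC.
        by exists C; split; [exact: FP|left; exact: BC|left|exact: sub].
      by exists B; split; [exact: FP|left|left; exact: CB|exact: sub].
    - by exists B; split; [exact: FP|left|right|exact: sub].
    - by exists C; split; [exact: FP|right|left|exact: sub].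
    - by exists set0; split=> //; [right|right|move=> c [//|]; right].
  split=> [a b ua ub|a b ua ub|us].
  - by have [B [[BB _ _] Ba Bb sub]] := cover _ _ ua ub; apply/sub/BB.
  - by have [B [[_ BM _] Ba Bb sub]] := cover _ _ ua ub; apply/sub/BM.
  - by have [B [[_ _ Bs] Ba _ _]] := cover _ _ us us.
pose O : {pred K} := [pred z | `[< ext B z >]].
have OP z : reflect (ext B z) (z \in O) by exact: asboolP.
have Oring : subring_closed O.
  split=> [|a b /OP Ba /OP Bb|a b /OP Ba /OP Bb].
  - by apply/OP; right; exact: rpred1.
  - exact/OP/BB.
  - exact/OP/BM.
pose O' : subringClosed K := HB.pack O (GRing.isSubringClosed.Build K O Oring).
have AO : {subset A <= O'} by move=> a aA; apply/OP; right.
have sVO : s^-1 \notin O' by apply/OP.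
suff total z : (z \in O') || (z^-1 \in O').
  have natO n : (n.+1%:R != 0 :> K) && (n.+1%:R^-1 \in O').
    by have /andP[-> /AO ->] := natA n.
  by exists (Place Oring total natO).
apply: (maximal_total (AO _ sA) sVO) => {}z zO.
apply: contrapT => noz; case/OP: zO.
pose C : set K := [set a | exists2 p, p \is a polyOver O' & a = p.[z]]%classic.
have BC : (ext B `<=` C)%classic.
  move=> b Bb; exists b%:P; last by rewrite hornerC.
  by rewrite polyOverC; apply/OP.
have extC : ext C = C.
  by apply/classical_sets.seteqP; split=> [a [//|Aa]|a Ca]; [apply: BC; right|left].
have zC : C z by exists 'X; rewrite ?polyOverX ?hornerX.
suff CB : (C `<=` B)%classic by left; exact: CB.
apply: contrapT => nCB; apply: (Bmax C).
  by split=> // b Bb; apply: BC; left.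
rewrite /P extC; split.
- move=> _ _ [p pO ->] [q qO ->]; exists (p - q); first exact: rpredB.
  by rewrite hornerD hornerN.
- move=> _ _ [p pO ->] [q qO ->]; exists (p * q); first exact: rpredM.
  by rewrite hornerM.
- by move=> [p pO E]; apply: noz; exists p.
Qed.

(** The subring of fractions with denominators in D avoids the inverse of s as
    soon as no multiple of s is a denominator. *)
Lemma fraction_place (K : fieldType) (B : idomainType) (psi : {rmorphism B -> K})
    (D : {pred B}) (s : B) :
  injective psi -> s != 0 -> 1 \in D -> {in D &, forall a b, a * b \in D} ->
  (forall n, n.+1%:R \in D) -> (forall p, s * p \notin D) ->
  exists v : place K, [/\ forall p, psi p \in integral v,
    forall d, d \in D -> (psi d)^-1 \in integral v & (psi s)^-1 \notin integral v].
Proof.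
move=> psiI s0 D1 DM Dn sD.
have D0 d : d \in D -> psi d != 0.
  rewrite -(rmorph0 psi) (inj_eq psiI) => dD; apply: contraTneq dD => ->.
  by rewrite -(mulr0 s) sD.
pose A : {pred K} := [pred z | `[< exists p d, d \in D /\ z = psi p / psi d >]].
have AP z : reflect (exists p d, d \in D /\ z = psi p / psi d) (z \in A).
  exact: asboolP.
have Aring : subring_closed A.
  split=> [|_ _ /AP[p [d [dD ->]]] /AP[q [e [eD ->]]]|
            _ _ /AP[p [d [dD ->]]] /AP[q [e [eD ->]]]]; apply/AP.
  - by exists 1, 1; rewrite rmorph1 divr1.
  - exists (p * e - q * d), (d * e); split; first exact: DM.
    by rewrite rmorphB !rmorphM; move: (D0 _ dD) (D0 _ eD) => d0 e0; field; rewrite d0 e0.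
  - exists (p * q), (d * e); split; first exact: DM.
    by rewrite !rmorphM mulf_div.
pose A' : subringClosed K := HB.pack A (GRing.isSubringClosed.Build K A Aring).
have psiA p : psi p \in A' by apply/AP; exists p, 1; rewrite rmorph1 divr1.
have DA d : d \in D -> (psi d)^-1 \in A'.
  by move=> dD; apply/AP; exists 1, d; rewrite rmorph1 mul1r.
have [n||v Av sv] := @place_above K A' (psi s) _ (psiA s).
- by rewrite -(rmorph_nat psi) D0 ?DA.
- apply/AP => -[p [d [dD E]]]; move: (sD p).
  have ps0 : psi s != 0 by rewrite -(rmorph0 psi) (inj_eq psiI).
  suff -> : s * p = d by rewrite dD.
  apply: psiI; rewrite rmorphM -[psi p](divfK (D0 _ dD)) -E.
  by rewrite mulrA divff // mul1r.
by exists v; split=> [p|d dD|]; [exact/Av/psiA|exact/Av/DA|].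
Qed.

(** * The maximal ideal and Hensel's lemma *)

Section Ideal.
Variables (K : fieldType) (v : place K).
Local Notation O := (integral v).
Local Notation M := (infinitesimal v).
Implicit Types a b z : K.

Lemma infinitesimalE z : (z \in M) = (z == 0) || (z^-1 \notin O).
Proof. by []. Qed.

Lemma inf_int z : z \in M -> z \in O.
Proof.
rewrite infinitesimalE => /predU1P[->|zV]; first exact: rpred0.
by have := integral_total v z; rewrite (negbTE zV) orbF.
Qed.

Lemma intV z : z \notin M -> z^-1 \in O.
Proof. by rewrite infinitesimalE negb_or negbK => /andP[]. Qed.

Lemma notinf_neq0 z : z \notin M -> z != 0.
Proof. by rewrite infinitesimalE negb_or => /andP[]. Qed.

Lemma infMl a b : a \in O -> b \in M -> a * b \in M.
Proof.
move=> aO; rewrite !infinitesimalE mulf_eq0 => /predU1P[->|bV].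
  by rewrite eqxx orbT.
have [//|a0] := eqVneq a 0; apply/orP; right; apply: contra bV => abO.
by have := rpredM aO abO; rewrite invfM mulVKf.
Qed.

Lemma infMr a b : a \in M -> b \in O -> a * b \in M.
Proof. by move=> aM bO; rewrite mulrC infMl. Qed.

Lemma infMinf a b : a \in M -> b \in M -> a * b \in M.
Proof. by move=> aM bM; apply: infMr => //; apply: inf_int. Qed.

Lemma zero_inf : 0 \in M. Proof. by rewrite infinitesimalE eqxx. Qed.

Lemma one_notinf : 1 \notin M.
Proof. by rewrite infinitesimalE invr1 rpred1 oner_eq0. Qed.

Lemma inf_zmod_closed : zmod_closed M.
Proof.
split=> [|a b aM bM]; first exact: zero_inf.
have [->|a0] := eqVneq a 0.
  by rewrite sub0r -mulN1r infMl // rpredN rpred1.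
have [->|b0] := eqVneq b 0; first by rewrite subr0.
have [abO|baO] := orP (integral_total v (a / b)).
  have -> : a - b = (a / b - 1) * b by field.
  by rewrite infMl // rpredB ?rpred1.
have -> : a - b = (1 - (a / b)^-1) * a by field; rewrite b0.
by rewrite infMl // rpredB ?rpred1.
Qed.

End Ideal.

HB.instance Definition _ (K : fieldType) (v : place K) :=
  GRing.isZmodClosed.Build K (infinitesimal v) (inf_zmod_closed v).

(** Congruence modulo M is written a - b \in M. *)
Section Residues.
Variables (K : fieldType) (v : place K).
Local Notation O := (integral v).
Local Notation M := (infinitesimal v).
Implicit Types a b z : K.

Lemma inf_exp z n : (0 < n)%N -> z \in M -> z ^+ n \in M.
Proof.
by case: n => // n _ zM; rewrite exprS infMr // rpredX // inf_int.
Qed.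

Lemma inf_root z n : z ^+ n \in M -> z \in M.
Proof.
apply: contraTT => zM; rewrite infinitesimalE negb_or expf_eq0.
by rewrite (negbTE (notinf_neq0 zM)) andbF /= -exprVn negbK rpredX // intV.
Qed.

Lemma int_root z n : (0 < n)%N -> z ^+ n \in O -> z \in O.
Proof.
case: n => // n _ znO; have [//|zV] := orP (integral_total v z).
have [->|z0] := eqVneq z 0; first exact: rpred0.
have -> : z = z ^+ n.+1 * z^-1 ^+ n.
  by rewrite exprS exprVn mulfK // expf_neq0.
by rewrite rpredM // rpredX.
Qed.

Lemma intV_notinf z : z != 0 -> (z^-1 \in O) = (z \notin M).
Proof. by move=> z0; rewrite infinitesimalE negb_or z0 negbK. Qed.

Lemma notinfM a b : a \notin M -> b \notin M -> a * b \notin M.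
Proof.
move=> aM bM; apply: contra aM => abM.
by have := infMr abM (intV bM); rewrite mulfK // (notinf_neq0 bM).
Qed.

Lemma natr_notinf n : n.+1%:R \notin M.
Proof.
by have /andP[n0 nV] := integral_natV v n; rewrite -intV_notinf.
Qed.

Lemma intr_notinf (i : int) : i != 0 -> i%:~R \notin M.
Proof.
case: i => [[|n] // _|n _]; first exact: natr_notinf.
by rewrite NegzE mulrNz rpredN natr_notinf.
Qed.

Lemma int_unit1 a : a - 1 \in M -> a \notin M.
Proof.
move=> a1; apply: contra (one_notinf v) => aM.
by rewrite -(subKr a 1) rpredB // .
Qed.

Lemma int_eqv a b : a - b \in M -> b \in O -> a \in O.
Proof. by move=> /inf_int abO bO; rewrite -(subrK b a) rpredD. Qed.

Lemma int_near1 a : a - 1 \in M -> a \in O.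
Proof. by move=> /int_eqv; apply; rewrite rpred1. Qed.

Lemma inf_eqv a b : a - b \in M -> (a \in M) = (b \in M).
Proof.
by move=> ab; apply/idP/idP => h; [rewrite -(subKr a b)|rewrite -(subrK b a)];
  rewrite (rpredB, rpredD).
Qed.

Lemma eqvM a b c d : a \in O -> d \in O -> a - b \in M -> c - d \in M ->
  a * c - b * d \in M.
Proof.
move=> aO dO ab cd; have -> : a * c - b * d = a * (c - d) + (a - b) * d by ring.
by apply: rpredD; [exact: infMl|exact: infMr].
Qed.

Lemma eqvX a b n : a \in O -> b \in O -> a - b \in M -> a ^+ n - b ^+ n \in M.
Proof.
move=> aO bO ab; elim: n => [|n IH]; first by rewrite !expr0 subrr rpred0.
by rewrite !exprS eqvM // rpredX.
Qed.

Lemma near1M w z : w - 1 \in M -> z - 1 \in M -> w * z - 1 \in M.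
Proof. by move=> wM zM; rewrite -[X in _ - X]mulr1 eqvM ?rpred1 ?int_near1. Qed.

Lemma near1V w : w - 1 \in M -> w^-1 - 1 \in M.
Proof.
move=> wM; have wn := int_unit1 wM; have w0 := notinf_neq0 wn.
have -> : w^-1 - 1 = - (w - 1) * w^-1 by field.
by rewrite infMr ?rpredN ?intV.
Qed.

Lemma near1_expz w j : w - 1 \in M -> w ^ j - 1 \in M.
Proof.
have near1X n : w - 1 \in M -> w ^+ n - 1 \in M.
  by move=> wM; rewrite -(expr1n _ n) eqvX ?rpred1 ?int_near1.
by case: j => n wM; [exact: near1X|exact/near1V/near1X].
Qed.

Lemma inf_near1 a : a \in M -> 1 + a - 1 \in M.
Proof. by rewrite addrC addKr. Qed.

Lemma inf_unit a : a \in M -> 1 + a \notin M.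
Proof. by move=> /inf_near1/int_unit1. Qed.

Lemma inf_unit_neq0 a : a \in M -> 1 + a != 0.
Proof. by move=> /inf_unit/notinf_neq0. Qed.

End Residues.

Lemma log_deriv (K : fieldType) (r : seq K) (a : K) :
    (forall z, z \in r -> a - z != 0) ->
  (\prod_(z <- r) ('X - z%:P))^`().[a] =
  (\prod_(z <- r) ('X - z%:P)).[a] * \sum_(z <- r) (a - z)^-1.
Proof.
elim: r => [|z r IH] nz; first by rewrite !big_nil derivC horner0 mulr0.
rewrite !big_cons derivM derivXsubC mul1r hornerD !hornerM IH; last first.
  by move=> u ur; rewrite nz // inE ur orbT.
have := nz z (mem_head _ _); rewrite hornerXsubC => nz0.
by field.
Qed.

(** If no root of P were congruent to a, then all 1 / (a - z) would be in O,
    and the logarithmic derivative would make P'(a) a multiple of P(a) in O. *)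
Lemma hensel (K : closedFieldType) (v : place K) (P : {poly K}) (a : K) :
    P.[a] \in infinitesimal v -> P^`().[a] \notin infinitesimal v ->
  exists2 z, root P z & z - a \in infinitesimal v.
Proof.
move=> PaM P'aM; have [r rE] := closed_field_poly_normal P.
have [ra|nra] := boolP (root P a).
  by exists a; rewrite // subrr rpred0.
have P0 : P != 0 by apply: contraNneq P'aM => ->; rewrite derivC horner0 rpred0.
have rP z : z \in r -> root P z.
  by rewrite rE rootZ ?lead_coef_eq0 // root_prod_XsubC.
have [/hasP[z zr zM]|/hasPn none] :=
    boolP (has (fun z => z - a \in infinitesimal v) r).
  by exists z; rewrite ?rP.
case/negP: P'aM; rewrite rE derivZ hornerZ log_deriv; last first.
  move=> z zr; rewrite subr_eq0; apply: contraNneq nra => ->; exact: rP.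
rewrite mulrA -hornerZ -rE infMr // big_seq rpred_sum // => z zr.
by rewrite intV // -opprB rpredN none.
Qed.

Lemma closed_root (K : closedFieldType) (n : nat) (c : K) :
  (0 < n)%N -> exists z, z ^+ n = c.
Proof.
move=> n0; have /closed_rootP[z] : size ('X^n - c%:P) != 1 by rewrite size_XnsubC // eqSS -lt0n.
by rewrite /root hornerD hornerN hornerXn hornerC subr_eq0 => /eqP; exists z.
Qed.

(** A Laurent polynomial in which one monomial dominates at z = 1 takes every
    value t close to 1 at some point close to 1; multiplying by z^N turns this
    into a polynomial equation whose derivative at 1 is congruent to e b. *)
Lemma hensel_laurent (K : closedFieldType) (v : place K) (T : eqType)
    (s : seq T) (c : T -> K) (e : T -> int) (b : T) (t : K) :
    uniq s -> b \in s -> e b != 0 -> c b = 1 -> t - 1 \in infinitesimal v ->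
    {in s, forall i, i != b -> c i \in infinitesimal v} ->
  exists2 z, z - 1 \in infinitesimal v & \sum_(i <- s) c i * z ^ e i = t.
Proof.
move=> us bs eb cb tM cM; set M := infinitesimal v.
(* Large enough to clear the negative exponents. *)
pose N := (\sum_(i <- s) `|e i|)%N.
pose d i := absz (e i + N%:Z).
have eN i : i \in s -> (d i)%:Z = e i + N%:Z.
  move=> is_; rewrite gez0_abs // /N (big_rem i) //=; lia.
pose P := \sum_(i <- s) c i *: 'X^(d i) - t *: 'X^N.
have sumM (f : T -> K) : (forall i, f i \in integral v) ->
    \sum_(i <- s) c i * f i - f b \in M.
  move=> fO; rewrite (big_rem b) //= cb mul1r addrAC subrr add0r.
  rewrite big_seq rpred_sum // => i; rewrite (mem_rem_uniq b us) inE => /andP[ib is_].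
  by rewrite infMr // cM.
have [||z zP zM] := @hensel K v P 1.
- rewrite /P hornerD hornerN horner_sum hornerZ hornerXn expr1n mulr1.
  under eq_bigr => i _ do rewrite hornerZ hornerXn expr1n.
  rewrite -(subrKA 1) rpredD ?sumM ?rpred1 //.
  by rewrite -opprB rpredN.
- rewrite /P derivB raddf_sum /= derivZ derivXn hornerD hornerN horner_sum hornerZ.
  under eq_bigr => i _ do rewrite derivZ derivXn hornerZ hornerMn hornerXn expr1n.
  rewrite hornerMn hornerXn expr1n.
  rewrite (inf_eqv (b := (e b)%:~R)) ?intr_notinf //.
  have -> : (e b)%:~R = (d b)%:R - N%:R :> K.
    by rewrite -[_%:R]/((d b)%:Z%:~R) eN // rmorphD /= addrK.
  have := sumM (fun i => (d i)%:R) (fun i => rpred_nat _ _).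
  set S := \sum_(i <- s) _ => h.
  rewrite (_ : _ - _ = S - (d b)%:R - (t - 1) * N%:R); last by ring.
  by rewrite rpredB // infMr // rpred_nat.
have z0 : z != 0 by apply: notinf_neq0 (int_unit1 zM).
exists z => //; apply: (mulIf (expf_neq0 N z0)); rewrite mulr_suml.
move/rootP: zP; rewrite /P hornerD hornerN horner_sum hornerZ hornerXn.
move/eqP; rewrite subr_eq0 => /eqP <-.
rewrite big_seq [RHS]big_seq; apply: eq_bigr => i is_.
rewrite hornerZ hornerXn -mulrA; congr (_ * _).
by rewrite -[z ^+ N]/(z ^ N%:Z) -expfzDr // -eN.
Qed.

Lemma hensel_cubic (K : closedFieldType) (v : place K) (c0 c1 c2 c3 a : K) :
    c0 + c1 * a + c2 * a ^+ 2 + c3 * a ^+ 3 \in infinitesimal v ->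
    c1 + 2%:R * c2 * a + 3%:R * c3 * a ^+ 2 \notin infinitesimal v ->
  exists2 z, c0 + c1 * z + c2 * z ^+ 2 + c3 * z ^+ 3 = 0 & z - a \in infinitesimal v.
Proof.
pose P := c0%:P + c1 *: 'X + c2 *: 'X^2 + c3 *: 'X^3.
have PE z : P.[z] = c0 + c1 * z + c2 * z ^+ 2 + c3 * z ^+ 3.
  by rewrite /P !(hornerD, hornerZ, hornerXn, hornerX, hornerC).
have P'E z : P^`().[z] = c1 + 2%:R * c2 * z + 3%:R * c3 * z ^+ 2.
  rewrite /P !(derivD, derivZ, derivXn, derivX, derivC).
  rewrite !(hornerD, hornerZ, hornerMn, hornerXn, hornerX, hornerC); ring.
rewrite -PE -P'E => /hensel h /h[z /rootP zP zM]; exists z => //.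
by rewrite -PE.
Qed.

(** * Valuation rings adapted to an independent pair *)

(** Reading psi as evaluation at a pair (x, y), with x the outer variable: x is
    small and all nonzero polynomials in y alone are units. *)
Lemma place_small (F : fieldType) (K : fieldType)
    (psi : {rmorphism {poly {poly F}} -> K}) :
    injective psi -> (forall n, n.+1%:R != 0 :> F) ->
  exists v : place K, psi 'X \in infinitesimal v /\ forall q : {poly F}, q != 0 ->
    psi q%:P \in integral v /\ psi q%:P \notin infinitesimal v.
Proof.
move=> psiI F0.
pose D : {pred {poly {poly F}}} := [pred d : {poly {poly F}} | size d == 1].
have DC q : q != 0 -> q%:P \in D by move=> q0; rewrite inE size_polyC q0.
have [||||p|v [vO vD sv]] := @fraction_place K _ psi D 'X psiI.
- by rewrite polyX_eq0.
- by rewrite inE size_poly1.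
- move=> a b /size_poly1P[c c0 ->] /size_poly1P[d d0 ->].
  by rewrite -polyCM DC // mulf_neq0.
- by move=> n; rewrite -!polyC_natr DC // polyC_eq0 F0.
- rewrite inE mulrC; have [->|p0] := eqVneq p 0; first by rewrite mul0r size_poly0.
  by rewrite size_mulX // eqSS size_poly_eq0.
exists v; split; first by rewrite infinitesimalE sv orbT.
move=> q q0; split=> //; rewrite -intV_notinf ?vD ?DC //.
by rewrite -(rmorph0 psi) (inj_eq psiI) polyC_eq0.
Qed.

(** Composition of v with the place y = infinity of the function field F(y):
    the elements congruent modulo v to a polynomial in y^-1 form a subring that
    avoids y, because y is transcendental over F modulo v.  Whatever was small
    for v stays small, even after multiplication by any power of y. *)
Lemma place_refine (F : fieldType) (K : fieldType) (psi : {rmorphism {poly F} -> K})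
    (v : place K) : (forall n, n.+1%:R != 0 :> F) ->
    (forall q, q != 0 -> psi q \in integral v /\ psi q \notin infinitesimal v) ->
  exists w : place K, {subset infinitesimal v <= infinitesimal w} /\
    (psi 'X)^-1 \in infinitesimal w.
Proof.
move=> F0 psiv.
have psiO q : psi q \in integral v.
  by have [->|/psiv[]//] := eqVneq q 0; rewrite rmorph0 rpred0.
set y := psi 'X.
have [yO yM] : y \in integral v /\ y \notin infinitesimal v.
  by apply: psiv; rewrite polyX_eq0.
have y0 : y != 0 by exact: notinf_neq0 yM.
have yVO : y^-1 \in integral v by rewrite intV.
pose ev (p : {poly F}) := (map_poly (psi \o polyC) p).[y^-1].
have evO p : ev p \in integral v.
  rewrite /ev horner_coef rpred_sum // => i _; rewrite rpredM ?rpredX //.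
  by rewrite coef_map psiO.
pose A : {pred K} := [pred z | `[< exists p, z - ev p \in infinitesimal v >]].
have AP z : reflect (exists p, z - ev p \in infinitesimal v) (z \in A).
  exact: asboolP.
have Aring : subring_closed A.
  split=> [|a b /AP[p ap] /AP[q bq]|a b /AP[p ap] /AP[q bq]]; apply/AP.
  - by exists 1; rewrite /ev rmorph1 hornerC subrr rpred0.
  - exists (p - q); have -> : a - b - ev (p - q) = (a - ev p) - (b - ev q).
      by rewrite /ev rmorphB hornerD hornerN; ring.
    exact: rpredB.
  - exists (p * q); rewrite /ev rmorphM hornerM eqvM //.
      exact: int_eqv ap (evO p).
    exact: evO.
pose A' : subringClosed K := HB.pack A (GRing.isSubringClosed.Build K A Aring).
have A_inf z : z \in infinitesimal v -> z \in A'.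
  by move=> zM; apply/AP; exists 0; rewrite /ev rmorph0 horner0 subr0.
have [n|||w Aw yw] := @place_above K A' y^-1.
- have -> : n.+1%:R = psi (n.+1%:R%:P) by rewrite !rmorph_nat.
  have n0 : n.+1%:R%:P != 0 :> {poly F} by rewrite polyC_eq0.
  have [nO nM] := psiv _ n0; rewrite (notinf_neq0 nM); apply/AP.
  exists (n.+1%:R^-1)%:P; rewrite /ev map_polyC hornerC /=.
  have -> : psi (n.+1%:R^-1)%:P = (psi n.+1%:R%:P)^-1.
    by apply: (mulfI (notinf_neq0 nM)); rewrite divff ?(notinf_neq0 nM) // -rmorphM
      -polyCM divff // rmorph1.
  by rewrite subrr rpred0.
- apply/AP; exists 'X; rewrite /ev map_polyX hornerX subrr; exact: rpred0.
- rewrite invrK; apply/AP => -[p yp].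
  pose n := size p.
  (* If y were congruent to p.[y^-1], then q.[y] = y^n (y - p.[y^-1]) would be small. *)
  pose q : {poly F} := 'X^(n.+1) - \sum_(i < n) p`_i *: 'X^(n - i).
  have q0 : q != 0.
    apply/eqP => /(congr1 (fun r : {poly F} => r`_n.+1)) /eqP.
    rewrite coefB coefXn eqxx coef0 coef_sum big1 ?subr0 ?oner_eq0 // => i _.
    rewrite coefZ coefXn; case: eqP => [E|]; last by rewrite mulr0.
    by have := leq_subr i n; rewrite -E ltnn.
  have [_ /negP] := psiv q q0; apply.
  suff -> : psi q = (y - ev p) * y ^+ n by rewrite infMr // rpredX.
  rewrite /q rmorphB rmorphXn exprS mulrBl; congr (_ - _).
  rewrite /ev (@horner_coef_wide _ n) ?size_map_poly //.
  rewrite mulr_suml rmorph_sum; apply: eq_bigr => i _.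
  rewrite coef_map -mul_polyC rmorphM rmorphXn /= -mulrA exprVn; congr (_ * _).
  by rewrite mulrC -exprB ?unitfE // ltnW.
have yVM : y^-1 \in infinitesimal w by rewrite infinitesimalE yw orbT.
exists w; split=> // z zM; rewrite -[z](mulKf y0) infMr //.
by apply/Aw/A_inf; rewrite infMl.
Qed.

(** * Moves inside an orbit and criteria for infinity *)

Definition reach (K : fieldType) (S : {fset int * int}) : K * K -> K * K -> Prop :=
  clos_refl_trans (K * K) (adjacent S).

Section Reach.
Variables (K : fieldType) (S : {fset int * int}).
Implicit Types (x y : K) (u : K * K).

Lemma reach_refl u : reach S u u.
Proof. exact: rt_refl. Qed.

Lemma reach_trans u1 u2 u3 : reach S u1 u2 -> reach S u2 u3 -> reach S u1 u3.
Proof. exact: rt_trans. Qed.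

Lemma reach_vert x y y' : x != 0 -> y != 0 -> y' != 0 ->
  step_poly S (x, y) = step_poly S (x, y') -> reach S (x, y) (x, y').
Proof.
move=> x0 y0 y'0 E; have [<-|yy'] := eqVneq y y'; first exact: reach_refl.
apply: rt_step; split=> //=; first by rewrite x0 y0 y'0.
  by rewrite xpair_eqE negb_and yy' orbT.
by rewrite eqxx yy'.
Qed.

Lemma reach_horiz x x' y : x != 0 -> x' != 0 -> y != 0 ->
  step_poly S (x, y) = step_poly S (x', y) -> reach S (x, y) (x', y).
Proof.
move=> x0 x'0 y0 E; have [<-|xx'] := eqVneq x x'; first exact: reach_refl.
apply: rt_step; split=> //=; first by rewrite x0 y0 x'0.
  by rewrite xpair_eqE negb_and xx'.
by rewrite eqxx xx'.
Qed.
End Reach.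

Lemma infinite_reach (K : fieldType) (S : {fset int * int}) (u w : K * K) :
  reach S u w -> infinite_set [set z | reach S w z]%classic ->
  infinite_set [set z | reach S u z]%classic.
Proof.
move=> uw infw finu; apply: infw; apply: sub_finite_set finu => z /= wz.
exact: reach_trans uw wz.
Qed.

Lemma infinite_sequence (T : Type) (A : set T) (u : nat -> T) :
  injective u -> (forall n, A (u n)) -> infinite_set A.
Proof.
move=> uI uA finA; apply: infinite_nat.
have -> : [set: nat]%classic = (u @^-1` A)%classic.
  by apply/esym/classical_sets.seteqP; split=> // n _; exact: uA.
by apply: finite_preimage finA => n m _ _; exact: uI.
Qed.

Lemma infinite_indexed (T : Type) (A : set T) (I : nat -> T -> Prop) :
  (forall n, exists2 p, A p & I n p) -> (forall n m p, I n p -> I m p -> n = m) ->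
  infinite_set A.
Proof.
move=> ex disj; have /choice[u uP] : forall n, exists p, A p /\ I n p.
  by move=> n; have [p Ap Ip] := ex n; exists p.
apply: (@infinite_sequence _ _ u) => [n m unm|n]; last by have [] := uP n.
by apply: (disj n m (u n)); [have [] := uP n|rewrite unm; have [] := uP m].
Qed.

Lemma progression_inj (K : fieldType) (v : place K) (y c : K) :
    c \notin infinitesimal v ->
  forall n m (u : K * K), u.2 - y - n%:R * c \in infinitesimal v ->
    u.2 - y - m%:R * c \in infinitesimal v -> n = m.
Proof.
move=> cM n m u; wlog nm : n m / (n <= m)%N => [hw Inu Imu|].
  by case/orP: (leq_total n m) => h; [exact: hw|apply/esym/hw].
move: nm; rewrite leq_eqVlt => /predU1P[//|nm] Inu Imu; case/negP: cM.
have := rpredB Inu Imu; rewrite opprB addrC subrKA -mulrBl -natrB ?(ltnW nm) //.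
rewrite -(subnSK nm) => /(infMl (intV (natr_notinf v (m - n.+1)))).
by rewrite mulKf // (notinf_neq0 (natr_notinf v _)).
Qed.

(** Along the chain, quotients of first coordinates are in M, and 1 is not. *)
Lemma infinite_chain (K : fieldType) (v : place K) (S : {fset int * int})
    (P : K * K -> Prop) (p0 : K * K) :
    P p0 -> (forall p, P p -> p.1 != 0) ->
    (forall p, P p -> exists2 q, reach S p q & P q /\ q.1 / p.1 \in infinitesimal v) ->
  infinite_set [set p | reach S p0 p]%classic.
Proof.
move=> Pp0 P1 step.
have /choice[f fP] : forall p, exists q,
    P p -> [/\ reach S p q, P q & q.1 / p.1 \in infinitesimal v].
  move=> p; have [Pp|nPp] := asboolP (P p); last by exists p.
  by have [q pq [Pq qp]] := step p Pp; exists q.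
pose u n := iter n f p0.
have Pu n : P (u n) by elim: n => //= n /fP[].
have lt_inf n k : (u (n + k.+1)%N).1 / (u n).1 \in infinitesimal v.
  elim: k => [|k IH]; first by rewrite addn1; have [] := fP _ (Pu n).
  have [_ _ h] := fP _ (Pu (n + k.+1)%N); rewrite addnS /=.
  by have := infMinf h IH; rewrite mulrA divfK // P1.
apply: (@infinite_sequence _ _ u) => [n m|n]; last first.
  elim: n => [|n IH]; first exact: reach_refl.
  by apply: reach_trans IH _; have [] := fP _ (Pu n).
wlog nm : n m / (n <= m)%N => [hw|] unm.
  by case/orP: (leq_total n m) => h; [exact: hw|apply/esym/hw].
move: nm; rewrite leq_eqVlt => /predU1P[//|nm].
have := lt_inf n (m - n.+1)%N; rewrite addnS -addSn subnKC // -unm.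
by rewrite divff ?P1 // (negbTE (one_notinf v)).
Qed.

(** * Monomials and moves between dominant monomials *)

Definition mono (K : fieldType) (x y : K) (i j : int) : K := x ^ i * y ^ j.

Section Mono.
Variables (K : closedFieldType) (v : place K).
Local Notation M := (infinitesimal v).
Implicit Types (x y : K) (i j a b c d : int).

Lemma monoD x y i j a b : x != 0 -> y != 0 ->
  mono x y (i + a) (j + b) = mono x y i j * mono x y a b.
Proof. by move=> x0 y0; rewrite /mono !expfzDr // mulrACA. Qed.

Lemma monoX x y i j (n : nat) : mono x y i j ^+ n = mono x y (i * n) (j * n).
Proof. by rewrite /mono exprMn -!exprz_exp. Qed.

Lemma mono_neq0 x y i j : x != 0 -> y != 0 -> mono x y i j != 0.
Proof. by move=> x0 y0; rewrite mulf_neq0 ?expfz_neq0. Qed.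

(** The exponents of small monomials form a convex cone: by Cramer's rule a
    positive multiple of (i, j) is a nonnegative combination of (a, b) and
    (c, d), and M is a prime ideal. *)
Lemma mono_cone x y a b c d i j : x != 0 -> y != 0 ->
    mono x y a b \in M -> mono x y c d \in M ->
    0 < a * d - b * c -> 0 <= i * d - j * c -> 0 <= j * a - i * b ->
    (i != 0) || (j != 0) ->
  mono x y i j \in M.
Proof.
move=> x0 y0 abM cdM.
move Dp : (i * d - j * c) => p; move Dq : (j * a - i * b) => q.
move Dn : (a * d - b * c) => n.
case: n Dn => // n Dn n0; case: p Dp => // p Dp _; case: q Dq => // q Dq _ ij.
apply: (@inf_root _ _ _ n); rewrite monoX.
have -> : mono x y (i * n) (j * n) = mono x y a b ^+ p * mono x y c d ^+ q.
  by rewrite !monoX -monoD //; congr mono; rewrite -Dp -Dq -Dn; ring.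
have [p0|p0] := posnP p; last first.
  by rewrite infMr ?inf_exp // rpredX // inf_int.
have [q0|q0] := posnP q; last first.
  by rewrite infMl ?inf_exp // rpredX // inf_int.
have in0 : i * n = a * p + c * q by rewrite -Dn -Dp -Dq; ring.
have jn0 : j * n = b * p + d * q by rewrite -Dn -Dp -Dq; ring.
by move: in0 jn0 n0 ij; rewrite p0 q0; nia.
Qed.

(** A monomial in x and y' is, up to a root and a unit, one in x and y. *)
Lemma mono_transfer x y y' c d (n : nat) w i j : x != 0 -> y' ^+ n = w * mono x y c d ->
    w - 1 \in M -> mono x y (i * n + j * c) (j * d) \in M ->
  mono x y' i j \in M.
Proof.
move=> x0 yE wM h; apply: (@inf_root _ _ _ n).
have -> : mono x y' i j ^+ n = w ^ j * mono x y (i * n + j * c) (j * d).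
  have -> : mono x y' i j ^+ n = x ^ (i * n) * (y' ^+ n) ^ j.
    by rewrite /mono exprMn -[y' ^+ n ^ j](exprzAC y' j n) -exprz_exp.
  by rewrite yE /mono !expfzMl !exprz_exp expfzDr // [c * j]mulrC [d * j]mulrC; ring.
by rewrite infMl // int_near1 // near1_expz.
Qed.

Lemma mono_transferl x y x' c d (n : nat) w i j : y != 0 ->
    x' ^+ n = w * mono x y c d -> w - 1 \in M ->
    mono x y (i * c) (j * n + i * d) \in M ->
  mono x' y i j \in M.
Proof.
rewrite /mono ![_ ^ c * _]mulrC ![_ ^ (i * c) * _]mulrC [_ ^ i * _]mulrC.
exact: mono_transfer.
Qed.
End Mono.

Definition term (K : fieldType) (u : K * K) (s : int * int) : K := mono u.1 u.2 s.1 s.2.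

Section Moves.
Variables (K : closedFieldType) (v : place K) (S : {fset int * int}).
Local Notation M := (infinitesimal v).
Implicit Types (x y : K) (u : K * K) (a b s : int * int).

(** The tropical point of u lies in the region where the monomial a of the step
    polynomial is the only one of least valuation. *)
Definition dominates u a :=
  forall s, s \in S -> s != a -> mono u.1 u.2 (s.1 - a.1) (s.2 - a.2) \in M.

Lemma monoB x y i j c d : x != 0 -> y != 0 ->
  mono x y (i - c) (j - d) = mono x y i j / mono x y c d.
Proof.
move=> x0 y0; rewrite -[in RHS](subrK c i) -[in RHS](subrK d j).
by rewrite [mono _ _ (_ + c) _]monoD // mulfK ?mono_neq0.
Qed.

(** When a dominates at u, b dominates at u', and these two terms agree, a factor
    close to 1 on one coordinate of u' corrects the value of S at u' to that at
    u.  The exponent e selects the coordinate. *)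
Lemma dominant_root a b u u' (e : int * int -> int) :
    u.1 != 0 -> u.2 != 0 -> u'.1 != 0 -> u'.2 != 0 ->
    a \in S -> b \in S -> e b != 0 -> dominates u a -> dominates u' b ->
    term u a = term u' b ->
  exists2 z, z - 1 \in M & \sum_(s <- S) term u' s * z ^ e s = step_poly S u.
Proof.
move=> u10 u20 u'10 u'20 aS bS eb ua u'b ab.
have ta0 : term u a != 0 by exact: mono_neq0.
have tb0 : term u' b != 0 by exact: mono_neq0.
have [|||z zM zE] := @hensel_laurent K v _ (enum_fset S)
    (fun s => term u' s / term u' b) e b (step_poly S u / term u a) (fset_uniq S) bS eb.
- by rewrite divff.
- rewrite /step_poly (big_rem a) //= mulrDl divff // addrAC subrr add0r.
  rewrite mulr_suml big_seq rpred_sum // => s.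
  rewrite (mem_rem_uniq _ (fset_uniq S)) inE => /andP[sa sS].
  by rewrite -monoB // ua.
- by move=> s sS sb; rewrite -monoB // u'b.
exists z => //; move: zE => /(congr1 ( *%R (term u a))).
rewrite mulrCA divff // mulr1 => <-; rewrite mulr_sumr ab.
by apply: eq_bigr => s _; move: (z ^ _) => w; field.
Qed.

Lemma exprz_sg x y z (e c d i j : int) : e != 0 -> z ^+ `|e|%N = mono x y c d ->
  c = Num.sg e * i -> d = Num.sg e * j -> z ^ e = mono x y i j.
Proof.
case: e => [[|n]//|n] _ /= zE cE dE.
  by rewrite [LHS]zE cE dE !mul1r.
rewrite NegzE -invr_expz [z ^ _]zE cE dE /mono invfM !invr_expz.
by rewrite -[Num.sg _]/(-1)%Z !mulN1r !opprK.
Qed.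

(** From a point where a dominates one reaches a point (x, y') where b
    dominates: y' is the solution of term (x, y) a = term (x, y') b, up to a
    factor 1 + M.  The last hypothesis is the dominance of b at that solution,
    raised to the power |b.2| so that it only involves x and y. *)
Lemma vert_move a b x y (c d : int) :
    x != 0 -> y != 0 -> a \in S -> b \in S -> b.2 != 0 -> dominates (x, y) a ->
    c = Num.sg b.2 * (a.1 - b.1) -> d = Num.sg b.2 * a.2 ->
    (forall s, s \in S -> s != b -> mono x y
      ((s.1 - b.1) * `|b.2|%N + (s.2 - b.2) * c) ((s.2 - b.2) * d) \in M) ->
  exists y', [/\ y' != 0, reach S (x, y) (x, y') &
    exists2 w, w - 1 \in M & y' ^+ `|b.2|%N = w * mono x y c d].
Proof.
move=> x0 y0 aS bS b0 xya cE dE xyb.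
have n0 : (0 < `|b.2|)%N by rewrite absz_gt0.
have [y' y'E] := closed_root (mono x y c d) n0.
have y'0 : y' != 0.
  by apply: contraTneq (mono_neq0 c d x0 y0) => y'0; rewrite -y'E y'0 expr0n (gtn_eqF n0) eqxx.
have bE := exprz_sg b0 y'E cE dE.
have ab : term (x, y) a = term (x, y') b.
  by rewrite /term /= /mono bE /mono mulrA -expfzDr // subrKC.
have y'b : dominates (x, y') b.
  move=> s sS sb; apply: (@mono_transfer _ v x y y' c d `|b.2|%N 1) => //.
  - by rewrite mul1r.
  - by rewrite subrr rpred0.
  - exact: xyb.
have [z zM zE] := @dominant_root a b (x, y) (x, y') snd x0 y0 x0 y'0 aS bS b0 xya y'b ab.
have z0 : z != 0 by apply: notinf_neq0 (int_unit1 zM).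
exists (y' * z); split; first by rewrite mulf_neq0.
  apply: reach_vert => //; first by rewrite mulf_neq0.
  rewrite -zE; apply: eq_bigr => s _.
  by rewrite /term /mono /= expfzMl mulrA.
exists (z ^+ `|b.2|%N); first exact: (near1_expz `|b.2|%N zM).
by rewrite exprMn y'E mulrC.
Qed.

Lemma horiz_move a b x y (c d : int) :
    x != 0 -> y != 0 -> a \in S -> b \in S -> b.1 != 0 -> dominates (x, y) a ->
    c = Num.sg b.1 * a.1 -> d = Num.sg b.1 * (a.2 - b.2) ->
    (forall s, s \in S -> s != b -> mono x y
      ((s.1 - b.1) * c) ((s.2 - b.2) * `|b.1|%N + (s.1 - b.1) * d) \in M) ->
  exists x', [/\ x' != 0, reach S (x, y) (x', y) &
    exists2 w, w - 1 \in M & x' ^+ `|b.1|%N = w * mono x y c d].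
Proof.
move=> x0 y0 aS bS b0 xya cE dE xyb.
have n0 : (0 < `|b.1|)%N by rewrite absz_gt0.
have [x' x'E] := closed_root (mono x y c d) n0.
have x'0 : x' != 0.
  by apply: contraTneq (mono_neq0 c d x0 y0) => x'0; rewrite -x'E x'0 expr0n (gtn_eqF n0) eqxx.
have bE := exprz_sg b0 x'E cE dE.
have ab : term (x, y) a = term (x', y) b.
  by rewrite /term /= /mono bE /mono -mulrA -expfzDr // subrK.
have x'b : dominates (x', y) b.
  move=> s sS sb; apply: (@mono_transferl _ v x y x' c d `|b.1|%N 1) => //.
  - by rewrite mul1r.
  - by rewrite subrr rpred0.
  - exact: xyb.
have [z zM zE] := @dominant_root a b (x, y) (x', y) fst x0 y0 x'0 y0 aS bS b0 xya x'b ab.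
have z0 : z != 0 by apply: notinf_neq0 (int_unit1 zM).
exists (x' * z); split; first by rewrite mulf_neq0.
  apply: reach_horiz => //; first by rewrite mulf_neq0.
  rewrite -zE; apply: eq_bigr => s _.
  by rewrite /term /mono /= expfzMl mulrAC.
exists (z ^+ `|b.1|%N); first exact: (near1_expz `|b.1|%N zM).
by rewrite exprMn x'E mulrC.
Qed.
End Moves.

(** * Loops on the tropical curve *)

Lemma pair_neq (s a : int * int) : s != a -> (s.1 - a.1 != 0) || (s.2 - a.2 != 0).
Proof. by case: s a => [k l] [i j]; rewrite xpair_eqE negb_and !subr_eq0. Qed.

(** With a = (-m, p) and b = (k, -n), the hypotheses place the point (i, j)
    weakly left of b, below a, and on the inner side of the line through a and
    b, whose normal is (v1, v2).  It is then also right of a and above b. *)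
Lemma corner_bounds (m p k n v1 v2 : nat) (i j : int) :
    (0 < v1)%N -> (0 < v2)%N -> (v2 * (p + n) = v1 * (k + m))%N ->
    i <= k%:Z -> j <= p%:Z -> 0 <= v1%:Z * (i + m%:Z) + v2%:Z * (j - p%:Z) ->
  [/\ 0 <= v1%:Z * (i - k%:Z) + v2%:Z * (j + n%:Z), 0 <= i + m%:Z & 0 <= j + n%:Z].
Proof.
move=> v10 v20 hv ik jp h.
have h' : 0 <= v1%:Z * (i - k%:Z) + v2%:Z * (j + n%:Z) by lia.
split=> //.
  have : 0 <= v2%:Z * (p%:Z - j) by nia.
  by nia.
have : 0 <= v1%:Z * (k%:Z - i) by nia.
by nia.
Qed.

(** With t large, the monomials a = (-m, p) and b = (k, -n) have the value of t on
    two edges of the tropical curve of S - t; both edges have positive slope and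
    meet at a vertex in the direction (v1, v2) from the origin.  A vertical move
    leads from the first edge to the second, a horizontal one leads back, each
    time closer to the vertex.  The two edges are told apart by the sign of the
    valuation of g = x^v2 y^-v1. *)
Lemma contracting_vertex (K : closedFieldType) (v : place K) (S : {fset int * int})
    (m p k n v1 v2 : nat) (x y : K) :
    (0 < m)%N -> (0 < p)%N -> (0 < k)%N -> (0 < n)%N -> (0 < v1)%N -> (0 < v2)%N ->
    (v2 * (p + n) = v1 * (k + m))%N ->
    (- m%:Z, p%:Z) \in S -> (k%:Z, - n%:Z) \in S ->
    (forall s : int * int, s \in S -> [/\ s.1 <= k%:Z, s.2 <= p%:Z &
       0 <= v1%:Z * (s.1 + m%:Z) + v2%:Z * (s.2 - p%:Z)]) ->
    x != 0 -> y != 0 -> x \in infinitesimal v -> mono x y v2 (- v1%:Z) \in infinitesimal v ->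
  infinite_set [set u | reach S (x, y) u]%classic.
Proof.
set M := infinitesimal v => m0 p0 k0 n0 v10 v20 hv aS bS hS x0 y0 xM gM.
pose a : int * int := (- m%:Z, p%:Z); pose b : int * int := (k%:Z, - n%:Z).
pose P u := [/\ u.1 != 0, u.2 != 0, mono u.1 u.2 1 0 \in M &
                mono u.1 u.2 v2 (- v1%:Z) \in M].
apply: (@infinite_chain K v S P (x, y)) => [|u []//|[{}x {}y] [/= {}x0 {}y0 {}xM {}gM]].
  by split=> //=; rewrite /mono expr1z expr0z mulr1.
have hv' : (v2%:Z * (p%:Z + n%:Z) = v1%:Z * (k%:Z + m%:Z)) by lia.
(* Exponents of small monomials at a point of the first edge. *)
have cone1 (i j : int) : (i != 0) || (j != 0) -> j <= 0 -> 0 <= v1%:Z * i + v2%:Z * j ->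
    mono x y i j \in M.
  by move=> ij j0 h; apply: (mono_cone x0 y0 gM xM) => //; clear -v10 j0 h; lia.
have Na : dominates v S (x, y) a.
  move=> s sS sa; have [h1 h2 h3] := hS s sS.
  apply: cone1 => /=; first exact: (pair_neq sa).
    by rewrite subr_le0.
  by rewrite opprK.
(* Exponents of small monomials at a point of the second edge. *)
have cone2 y' (i j : int) : y' != 0 -> mono x y' (- v2%:Z) v1 \in M ->
    mono x y' 1 0 \in M -> (i != 0) || (j != 0) -> 0 <= j ->
    0 <= v1%:Z * i + v2%:Z * j -> mono x y' i j \in M.
  move=> y'0 hM x'M ij j0 h; apply: (mono_cone x0 y'0 x'M hM) => //; clear -v10 j0 h; lia.
have sgN (i : nat) : (0 < i)%N -> Num.sg (- i%:Z) = -1.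
  by move=> i0; rewrite ltr0_sg // oppr_lt0.
have [|||s sS sb|y' [y'0 rV [w wM wE]]] := @vert_move K v S a b x y (m%:Z + k%:Z) (- p%:Z) x0 y0 aS bS _ Na.
- by rewrite oppr_eq0; case: (n) n0.
- by rewrite /= sgN //; ring.
- by rewrite /= sgN //; ring.
- have [h1 h2 h3] := hS s sS; have := pair_neq sb; rewrite /= opprK abszN absz_nat.
  have [] := corner_bounds v10 v20 hv h1 h2 h3.
  set A := s.1 - _; set B := s.2 + _ => AB0 _ B0 AB.
  apply: cone1.
  + apply: contraTT AB; rewrite !negb_or !negbK => /andP[/eqP e1 /eqP e2].
    clear -p0 n0 e1 e2.
    have B00 : B = 0 by nia.
    by move: e1; rewrite B00 eqxx andbT mul0r addr0 => ?; apply/eqP; nia.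
  + by clear -B0; nia.
  + rewrite (_ : _ + _ = n%:Z * (v1%:Z * A + v2%:Z * B)); first by clear -AB0; nia.
    apply/eqP; rewrite -subr_eq0.
    rewrite (_ : _ - _ = B * (v1%:Z * (k%:Z + m%:Z) - v2%:Z * (p%:Z + n%:Z))); last by ring.
    by rewrite hv' subrr mulr0.
rewrite /= abszN absz_nat in wE.
have bM : mono x y' (- v2%:Z) v1 \in M.
  apply: (mono_transfer x0 wE wM).
  apply: cone1; clear -v10 v20 p0 hv'; [|nia|].
    by apply/orP; right; nia.
  rewrite (_ : _ + _ = v1%:Z * (v1%:Z * (k%:Z + m%:Z) - v2%:Z * (p%:Z + n%:Z))).
    by rewrite hv' subrr mulr0.
  by ring.
have xM' : mono x y' 1 0 \in M by move: xM; rewrite /mono !expr0z.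
have Nb : dominates v S (x, y') b.
  move=> s sS sb; have [h1 h2 h3] := hS s sS; have := pair_neq sb; rewrite /= opprK.
  have [AB0 _ B0] := corner_bounds v10 v20 hv h1 h2 h3.
  by move=> AB; apply: cone2.
have [|||s sS sa|x' [x'0 rH [z zM zE]]] :=
  @horiz_move K v S b a x y' (- k%:Z) (n%:Z + p%:Z) x0 y'0 bS aS _ Nb.
- by rewrite /= oppr_eq0; case: (m) m0.
- by rewrite /= sgN //; ring.
- by rewrite /= sgN //; ring.
- have [h1 h2 h3] := hS s sS; have := pair_neq sa; rewrite /= opprK abszN absz_nat.
  have [_ A0 _] := corner_bounds v10 v20 hv h1 h2 h3; rewrite -(opprK m%:Z) in h3.
  move: A0 h2 h3; rewrite -[s.2 <= _]subr_le0 opprK; set A := s.1 + _; set B := s.2 - _ => A0 B0 AB0 AB.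
  apply: cone2 => //.
  + apply: contraTT AB; rewrite !negb_or !negbK => /andP[/eqP e1 /eqP e2].
    clear -k0 m0 e1 e2.
    have A00 : A = 0 by nia.
    by move: e2; rewrite A00 eqxx mul0r addr0 => ?; apply/eqP; nia.
  + clear -v20 v10 AB0 A0 hv'.
    have : 0 <= v2%:Z * (B * m%:Z + A * (n%:Z + p%:Z)).
      rewrite (_ : _ * _ = m%:Z * (v1%:Z * A + v2%:Z * B) + v1%:Z * k%:Z * A).
        by rewrite addr_ge0 // !mulr_ge0.
      apply/eqP; rewrite -subr_eq0.
      rewrite (_ : _ - _ = A * (v2%:Z * (p%:Z + n%:Z) - v1%:Z * (k%:Z + m%:Z))); last by ring.
      by rewrite hv' subrr mulr0.
    by rewrite pmulr_rge0.
  + clear -AB0 hv'.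
    rewrite (_ : _ + _ = m%:Z * (v1%:Z * A + v2%:Z * B)); first by rewrite mulr_ge0.
    apply/eqP; rewrite -subr_eq0.
    rewrite (_ : _ - _ = A * (v2%:Z * (p%:Z + n%:Z) - v1%:Z * (k%:Z + m%:Z))); last by ring.
    by rewrite hv' subrr mulr0.
rewrite /= abszN absz_nat in zE.
exists (x', y'); first exact: reach_trans rV rH.
split.
- split => //=.
    apply: (mono_transferl y'0 zE zM).
    apply: cone2 => [|||||//]; rewrite // ?mul1r ?mul0r ?add0r.
    - by apply/orP; right; clear -n0; lia.
    - by clear -hv' v10 m0; lia.
  apply: (mono_transferl y'0 zE zM).
  apply: cone2 => //; clear -m0 n0 v10 v20 k0 hv'.
  - by apply/orP; left; nia.
  - by nia.
  rewrite (_ : _ + _ = v2%:Z * (v2%:Z * (p%:Z + n%:Z) - v1%:Z * (k%:Z + m%:Z))).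
    by rewrite hv' subrr mulr0.
  by ring.
apply: (@inf_root _ _ _ m); rewrite expr_div_n zE.
have -> : z * mono x y' (- k%:Z) (n%:Z + p%:Z) / x ^+ m =
    z * mono x y' (- k%:Z - m%:Z) (n%:Z + p%:Z).
  rewrite /mono [x ^ (_ - _)]expfzDr // -[x ^ (- m%:Z)]exprnN.
  by move: (x ^ _) (y' ^ _) (x ^- m) => ? ? ?; ring.
rewrite infMl ?int_near1 //; apply: cone2 => [|||||//]; rewrite //.
- by apply/orP; right; clear -n0; lia.
- by clear -hv'; lia.
Qed.

(** One round visits the dominant monomials (-2, -1), (-1, 1), (1, 1), (1, -2)
    and returns to (-2, -1).  In each of the four regions two small monomials
    bound the tropical point, and they are transported by the moves.  Up to a
    unit, a round multiplies x by a fourth root of y / x, which is small. *)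
Lemma contracting_cycle (K : closedFieldType) (v : place K) (x y : K) (S : {fset int * int}) :
    S = [fset (-2, -1); (-1, 1); (0, 1); (1, -2); (1, 0); (1, 1)]%fset%Z ->
    x != 0 -> y != 0 -> mono x y 3 (-1) \in infinitesimal v ->
    mono x y (-1) 1 \in infinitesimal v ->
  infinite_set [set u | reach S (x, y) u]%classic.
Proof.
move=> SE; set M := infinitesimal v => x0 y0 gM hM.
pose P u := [/\ u.1 != 0, u.2 != 0, mono u.1 u.2 3 (-1) \in M &
                mono u.1 u.2 (-1) 1 \in M].
apply: (@infinite_chain K v S P (x, y)) => [//|u []//|[{}x {}y] [/= {}x0 {}y0 {}gM {}hM]].
have SP (Q : int * int -> Prop) (a : int * int) :
    ((-2, -1) != a -> Q (-2, -1)) -> ((-1, 1) != a -> Q (-1, 1)) ->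
    ((0, 1) != a -> Q (0, 1)) -> ((1, -2) != a -> Q (1, -2)) ->
    ((1, 0) != a -> Q (1, 0)) -> ((1, 1) != a -> Q (1, 1)) ->
    forall s, s \in S -> s != a -> Q s.
  move=> q1 q2 q3 q4 q5 q6 s; rewrite SE !inE -!orbA.
  by do 5?[case/orP]; move/eqP ->.
have aS : ((-2, -1) : int * int) \in S by rewrite SE !inE.
have bS : ((-1, 1) : int * int) \in S by rewrite SE !inE.
have cS : ((1, 1) : int * int) \in S by rewrite SE !inE.
have dS : ((1, -2) : int * int) \in S by rewrite SE !inE.
have [|||||y1 [y10 r1 [w1 w1M w1E]]] :=
  @vert_move K v S (-2, -1) (-1, 1) x y (-1) (-1) x0 y0 aS bS.
- by [].
- by apply: SP => //= _; apply: (mono_cone x0 y0 gM hM).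
- by [].
- by [].
- by apply: SP => //= _; apply: (mono_cone x0 y0 gM hM).
rewrite /= in w1E.
have g1 : mono x y1 (-2) (-1) \in M.
  by apply: (mono_transfer x0 w1E w1M); apply: (mono_cone x0 y0 gM hM).
have h1 : mono x y1 4 1 \in M.
  by apply: (mono_transfer x0 w1E w1M); apply: (mono_cone x0 y0 gM hM).
have [|||||x1 [x10 r2 [w2 w2M w2E]]] :=
  @horiz_move K v S (-1, 1) (1, 1) x y1 (-1) 0 x0 y10 bS cS.
- by [].
- by apply: SP => //= _; apply: (mono_cone x0 y10 g1 h1).
- by [].
- by [].
- by apply: SP => //= _; apply: (mono_cone x0 y10 g1 h1).
rewrite /= in w2E.
have g2 : mono x1 y1 (-4) 1 \in M.
  by apply: (mono_transferl y10 w2E w2M); apply: (mono_cone x0 y10 g1 h1).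
have h2 : mono x1 y1 2 (-1) \in M.
  by apply: (mono_transferl y10 w2E w2M); apply: (mono_cone x0 y10 g1 h1).
have [|||||y2 [y20 r3 [w3 w3M w3E]]] :=
  @vert_move K v S (1, 1) (1, -2) x1 y1 0 (-1) x10 y10 cS dS.
- by [].
- by apply: SP => //= _; apply: (mono_cone x10 y10 g2 h2).
- by [].
- by [].
- by apply: SP => //= _; apply: (mono_cone x10 y10 g2 h2).
rewrite /= in w3E.
have g3 : mono x1 y2 1 1 \in M.
  by apply: (mono_transfer x10 w3E w3M); apply: (mono_cone x10 y10 g2 h2).
have h3 : mono x1 y2 (-2) (-1) \in M.
  by apply: (mono_transfer x10 w3E w3M); apply: (mono_cone x10 y10 g2 h2).
have [|||||x2 [x20 r4 [w4 w4M w4E]]] :=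
  @horiz_move K v S (1, -2) (-2, -1) x1 y2 (-1) 1 x10 y20 dS aS.
- by [].
- by apply: SP => //= _; apply: (mono_cone x10 y20 g3 h3).
- by [].
- by [].
- by apply: SP => //= _; apply: (mono_cone x10 y20 g3 h3).
rewrite /= in w4E.
have g4 : mono x2 y2 3 (-1) \in M.
  by apply: (mono_transferl y20 w4E w4M); apply: (mono_cone x10 y20 g3 h3).
have h4 : mono x2 y2 (-1) 1 \in M.
  by apply: (mono_transferl y20 w4E w4M); apply: (mono_cone x10 y20 g3 h3).
exists (x2, y2).
  exact: (reach_trans r1 (reach_trans r2 (reach_trans r3 r4))).
split=> //; apply: (@inf_root _ _ _ 4).
have u0 w : w - 1 \in M -> w != 0 by move=> /int_unit1/notinf_neq0.
have -> : (x2 / x) ^+ 4 = w4 ^+ 2 * w3 / (w1 * w2 ^+ 2) * mono x y (-1) 1.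
  move: w1E w2E w3E w4E; rewrite /mono !expr1 !expr1z !expr0z !exprN1 mulr1 mul1r.
  move=> y1E x1E y2E x2E; rewrite expr_div_n (exprM x2 2 2) x2E !exprMn y2E y1E x1E.
  by field; rewrite x0 y0 !u0.
by rewrite infMl // ?int_near1 // near1M ?near1V ?near1M // (near1_expz 2).
Qed.

(** * The drift at x = 0, y = infinity *)

(** Here t is of the size of y0, and T = t / y0 is congruent to 1 + x0. *)
Section Drift.
Variables (K : closedFieldType) (v : place K) (S : {fset int * int}).
Local Notation M := (infinitesimal v).
Local Notation O := (integral v).
Hypothesis hS : forall x y : K, x != 0 -> y != 0 ->
  step_poly S (x, y) = (1 + x) * (y + y^-1 * (1 + x^-2)).
Variables (x0 y0 : K).
Hypotheses (x0O : x0 \in O) (x0M : x0 \notin M) (x01M : 1 + x0 \notin M).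
Hypotheses (y0n0 : y0 != 0) (y0V : y0^-1 \in M).

Let w := y0^-1.
Let t := step_poly S (x0, y0).
Let T := t * w.

Lemma drift_level : T - (1 + x0) \in M.
Proof.
have x00 := notinf_neq0 x0M.
rewrite /T /t hS //.
have -> : (1 + x0) * (y0 + y0^-1 * (1 + x0^-2)) * w - (1 + x0) =
    ((1 + x0) * (1 + x0^-1 ^+ 2)) * (w ^+ 2) by rewrite /w; field; rewrite y0n0 x00.
apply: infMl; last exact: inf_exp.
by rewrite rpredM // rpredD ?rpred1 // rpredX // intV.
Qed.

(** At a height y with w y congruent to 1 or to x0, the equation S = t has two
    small solutions x with x^2 x0 close to w^2, one for each sign.  Multiplying by
    x^2, it becomes a cubic in xi = x / (s w) that reduces to 1 = xi^2. *)
Lemma drift_horiz s x y : s ^+ 2 * x0 = 1 -> x != 0 -> y != 0 ->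
    step_poly S (x, y) = t -> w * y - 1 \in M \/ w * y - x0 \in M ->
  exists x', [/\ x' != 0, reach S (x, y) (x', y), step_poly S (x', y) = t &
    exists2 xi, xi - 1 \in M & x' = s * w * xi].
Proof.
move=> sE x_0 y_0 yt wy.
have x00 := notinf_neq0 x0M.
have s0 : s != 0 by apply: contra_eq_neq sE => ->; rewrite expr0n mul0r eq_sym oner_eq0.
have sO : s \in O.
  by apply: (@int_root _ _ _ 2) => //; rewrite -[_ ^+ 2](mulfK x00) sE mul1r intV.
have wyO : w * y \in O by case: wy => /int_eqv; apply; rewrite ?rpred1.
have swM : s * w \in M by rewrite infMl.
pose A := s ^+ 2 * ((w * y) ^+ 2 + w ^+ 2).
pose B := s ^+ 2 * T * (w * y).
have AO : A \in O by rewrite rpredM ?rpredD ?rpredX // inf_int.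
have wO : w \in O by exact: inf_int.
have ABM : A - B + 1 \in M.
  have -> : A - B + 1 = s ^+ 2 * ((w * y - 1) * (w * y - x0)
      + w * w - (T - (1 + x0)) * (w * y)) + (1 - s ^+ 2 * x0) by rewrite /A /B; ring.
  rewrite sE subrr addr0 infMl ?rpredX // rpredB //; last by rewrite infMr // drift_level.
  rewrite rpredD //; last by rewrite infMl.
  by case: wy => h; [apply: infMr|apply: infMl] => //; rewrite rpredB ?rpred1.
have [||z zP zM] := @hensel_cubic K v 1 (s * w) (A - B) (s * w * A) 1.
- rewrite !expr1n !mulr1.
  have -> : 1 + s * w + (A - B) + s * w * A = A - B + 1 + s * w * (A + 1) by ring.
  by rewrite rpredD // infMr // rpredD ?rpred1.
- rewrite !expr1n !mulr1 (inf_eqv (b := - 2%:R)) ?rpredN ?natr_notinf //.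
  rewrite (_ : _ - _ = 2%:R * (A - B + 1) + s * w * (3%:R * A + 1)); last by ring.
  apply: rpredD; first by rewrite infMl ?rpred_nat.
  by rewrite infMr // rpredD ?rpred1 // rpredM // rpred_nat.
have z0 : z != 0 by apply: notinf_neq0 (int_unit1 zM).
have w0 : w != 0 by rewrite invr_eq0.
have x'0 : s * w * z != 0 by rewrite !mulf_neq0.
have x't : step_poly S (s * w * z, y) = t.
  move: zP; rewrite /A /B /T => E.
  rewrite hS //; apply/eqP; rewrite -subr_eq0.
  rewrite -(mulrI_eq0 (x := (s * w * z) ^+ 2 * y)); last by apply/mulfI; rewrite !mulf_neq0 ?expf_neq0.
  apply/eqP; rewrite -E; field.
  by rewrite z0 w0 s0 y_0.
exists (s * w * z); split=> //; last by exists z.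
by apply: reach_horiz => //; rewrite yt x't.
Qed.

(** The two ordinates above x have product 1 + x^-2 and sum t / (1 + x). *)
Lemma drift_vert x y : x \in M -> x != 0 -> y != 0 -> step_poly S (x, y) = t ->
  exists y', [/\ y' != 0, reach S (x, y) (x, y'), step_poly S (x, y') = t &
    y' = t / (1 + x) - y].
Proof.
move=> xM x_0 y_0 yt.
have x1 := inf_unit_neq0 xM.
have D0 : 1 + x^-2 != 0.
  have -> : 1 + x^-2 = (1 + x ^+ 2) / x ^+ 2 by field.
  rewrite mulf_neq0 ?invr_eq0 ?expf_neq0 //.
  by apply: (@inf_unit_neq0 _ v); exact: inf_exp.
have y'0 : (1 + x^-2) / y != 0 by rewrite mulf_neq0 ?invr_eq0.
have E : step_poly S (x, (1 + x^-2) / y) = t.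
  by rewrite -yt !hS //; move: D0; set D := 1 + x ^- 2 => D0; field; rewrite D0 y_0.
exists ((1 + x^-2) / y); split => //; first by apply: reach_vert => //; rewrite yt E.
rewrite -yt hS //; field; rewrite x_0 y_0 x1 //.
Qed.

(** A round goes up and down, changing the sign of x in between:
    y'' - y = t / (1 + x') - t / (1 + x), with x and x' close to r w and -r w, is
    congruent to c = 2 (1 + x0) r. *)
Lemma drift_infinite : infinite_set [set u | reach S (x0, y0) u]%classic.
Proof.
have x00 := notinf_neq0 x0M.
have w0 : w != 0 by rewrite invr_eq0.
have wO : w \in O by exact: inf_int.
have [r rE'] := closed_root x0^-1 (isT : 0 < 2)%N.
have rE : r ^+ 2 * x0 = 1 by rewrite rE' mulVf.
have rNE : (- r) ^+ 2 * x0 = 1 by rewrite sqrrN.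
have r0 : r != 0 by apply: contra_eq_neq rE => ->; rewrite expr0n mul0r eq_sym oner_eq0.
have rO : r \in O by apply: (@int_root _ _ _ 2); rewrite // rE' intV.
have rM : r \notin M.
  apply: contra (one_notinf v) => rM; rewrite -rE mulrC infMl ?inf_exp //.
pose c := 2%:R * (1 + x0) * r.
have cM : c \notin M by rewrite !notinfM ?natr_notinf.
have cO : c \in O by rewrite !rpredM ?rpredD ?rpred1 ?rpred_nat.
(* Round n starts with x close to r w and y close to y0 + n c. *)
pose I (n : nat) (u : K * K) := u.2 - y0 - n%:R * c \in M.
pose Q (n : nat) (u : K * K) := [/\ u.1 != 0, u.2 != 0, reach S (x0, y0) u,
  step_poly S u = t & exists2 xi, xi - 1 \in M & u.1 = r * w * xi].
have wI n u : I n u -> w * u.2 - 1 \in M.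
  move=> Inu; have -> : w * u.2 - 1 = w * (u.2 - y0 - n%:R * c + n%:R * c).
    by rewrite /w; field.
  by rewrite infMr // rpredD ?(inf_int Inu) // rpredM // rpred_nat.
have small s xi : s \in O -> xi - 1 \in M -> s * w * xi \in M.
  by move=> sO xiM; apply: infMr; [exact: infMl|exact: int_near1].
apply: (@infinite_indexed _ _ I); last exact: progression_inj cM.
suff QI n : exists2 u, Q n u & I n u.
  by move=> n; have [u [_ _ ru _ _] Iu] := QI n; exists u.
elim: n => [|n [[x y] [/= x_0 y_0 rxy yt [xi xiM xE]] Inu]].
  have wy : w * y0 - 1 \in M by rewrite mulVf // subrr rpred0.
  have [x [x_0 rx xt xE]] := drift_horiz rE x00 y0n0 erefl (or_introl wy).
  by exists (x, y0); rewrite // /I /= subrr mul0r subrr rpred0.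
have wy := wI _ _ Inu; rewrite /= in wy.
have xM : x \in M by rewrite xE small.
have [y1 [y10 r1 y1t y1E]] := drift_vert xM x_0 y_0 yt.
have x1 := inf_unit xM; have x1n := notinf_neq0 x1.
have wy1 : w * y1 - x0 \in M.
  have -> : w * y1 - x0 = ((T - (1 + x0)) - x0 * x - x) / (1 + x) - (w * y - 1).
    by rewrite y1E /T; field.
  apply: rpredB => //; apply: infMr; last exact: intV.
  by apply: rpredB => //; apply: rpredB; [exact: drift_level|exact: infMl].
have [x1' [x1'0 r2 x1t [xi1 xi1M x1'E]]] := drift_horiz rNE x_0 y10 y1t (or_intror wy1).
have x1'M : x1' \in M by rewrite x1'E small ?rpredN.
have [y2 [y20 r3 y2t y2E]] := drift_vert x1'M x1'0 y10 x1t.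
have x2 := inf_unit x1'M; have x2n := notinf_neq0 x2.
have y2I : y2 - y - c \in M.
  have tE : t = T * y0 by rewrite /T /w mulfVK.
  have -> : y2 - y - c = (T * r * (xi + xi1) - c * (1 + x) * (1 + x1')) / ((1 + x) * (1 + x1')).
    have E : x - x1' = r * w * (xi + xi1) by rewrite xE x1'E; ring.
    have -> : T * r * (xi + xi1) = t * (x - x1') by rewrite E /T; ring.
    by rewrite y2E y1E; field; rewrite x1n x2n.
  apply: infMr; last by rewrite intV ?notinfM.
  have -> : T * r * (xi + xi1) - c * (1 + x) * (1 + x1') =
     (T - (1 + x0)) * r * (xi + xi1) + (1 + x0) * r * ((xi - 1) + (xi1 - 1))
     - c * (x + x1' + x * x1') by rewrite /c; ring.
  apply: rpredB; first apply: rpredD.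
  - apply: infMr; last by rewrite rpredD ?int_near1.
    by apply: infMr => //; exact: drift_level.
  - apply: infMl; last exact: rpredD.
    by rewrite rpredM // rpredD ?rpred1.
  - apply: infMl => //; apply: rpredD; [exact: rpredD|exact: infMinf].
have I2 : I n.+1 (x1', y2).
  rewrite /I /= in Inu *; have := rpredD Inu y2I; congr (_ \in M).
  by rewrite -natr1; ring.
have wy2 := wI _ _ I2; rewrite /= in wy2.
have [x2' [x2'0 r4 x2t x2E]] := drift_horiz rE x1'0 y20 y2t (or_introl wy2).
exists (x2', y2) => //; split=> //.
exact: (reach_trans rxy (reach_trans r1 (reach_trans r2 (reach_trans r3 r4)))).
Qed.
End Drift.

(** * The translation at x = infinity, y = infinity *)

Ltac solve_integral := repeat first
  [ assumption | exact: inf_int | exact: rpred1 | exact: rpred_nat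
  | apply: rpredD | rewrite rpredN | apply: rpredM | apply: rpredX ].

Section Translation.
Variables (K : closedFieldType) (v : place K) (S : {fset int * int}) (e : K).
Local Notation M := (infinitesimal v).
Local Notation O := (integral v).
Hypothesis eO : e \in O.
Hypothesis hS : forall x y : K, x != 0 -> y != 0 -> step_poly S (x, y) =
  x * (1 + y) + x^-2 * (1 + y^-2) + e * x^-1 * (1 + y^-1).

(** The pair is close to x = y = infinity, with x larger than all powers of y. *)
Definition far (x y : K) := [/\ x != 0, y != 0, y^-1 \in M &
  forall n, x^-1 * y ^+ n \in M].

(** The difference of the two values of S is divisible by y - y'; this is the
    vanishing of the quotient. *)
Lemma vert_quadratic x y y' : x != 0 -> y != 0 -> y' != 0 ->
    x ^+ 3 * y ^+ 2 * y' ^+ 2 = y + y' + e * x * y * y' ->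
  reach S (x, y) (x, y').
Proof.
move=> x0 y0 y'0 E; apply: reach_vert => //; rewrite !hS //; apply/eqP.
rewrite -subr_eq0; have -> : x * (1 + y) + x^-2 * (1 + y^-2) + e * x^-1 * (1 + y^-1) -
    (x * (1 + y') + x^-2 * (1 + y'^-2) + e * x^-1 * (1 + y'^-1)) =
    (y - y') * (x ^+ 3 * y ^+ 2 * y' ^+ 2 - (y + y' + e * x * y * y')) / (x ^+ 2 * y ^+ 2 * y' ^+ 2).
  by field; rewrite x0 y0 y'0.
by rewrite E subrr mulr0 mul0r.
Qed.

Lemma horiz_quadratic x x' y : x != 0 -> x' != 0 -> y != 0 ->
    (1 + y) * x ^+ 2 * x' ^+ 2 = (1 + y^-2) * (x + x') + e * (1 + y^-1) * x * x' ->
  reach S (x, y) (x', y).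
Proof.
move=> x0 x'0 y0 E; apply: reach_horiz => //; rewrite !hS //; apply/eqP.
rewrite -subr_eq0; have -> : x * (1 + y) + x^-2 * (1 + y^-2) + e * x^-1 * (1 + y^-1) -
    (x' * (1 + y) + x'^-2 * (1 + y^-2) + e * x'^-1 * (1 + y^-1)) =
    (x - x') * ((1 + y) * x ^+ 2 * x' ^+ 2 -
      ((1 + y^-2) * (x + x') + e * (1 + y^-1) * x * x')) / (x ^+ 2 * x' ^+ 2).
  by field; rewrite x0 y0 x'0.
by rewrite E subrr mulr0 mul0r.
Qed.

(** The equation for x' has degree 2.  One root is of the size of
    (1 + y^-2) / ((1 + y) x^2), which exceeds all powers of y. *)
Lemma climb x y : x != 0 -> y != 0 -> y^-1 \in M -> (forall n, x * y ^+ n \in M) ->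
  exists2 x', reach S (x, y) (x', y) & far x' y.
Proof.
move=> x0 y0 zM xyM; pose z := y^-1; pose g := 1 + z ^+ 2.
have xM : x \in M by have := xyM 0%N; rewrite mulr1.
have z2M : z ^+ 2 \in M by exact: inf_exp.
have gU := inf_unit z2M; have g0 := inf_unit_neq0 z2M; rewrite -/g in gU g0.
have gV := intV gU.
have z1 := inf_unit zM; have z10 := inf_unit_neq0 zM; rewrite -/z in z1 z10.
have z1O : 1 + z \in O by rewrite rpredD ?rpred1 // inf_int.
have yE : 1 + y = y * (1 + z) by rewrite /z; field.
have y1 : 1 + y != 0 by rewrite yE mulf_neq0.
pose xs := g / ((1 + y) * x ^+ 2).
have xs0 : xs != 0 by rewrite mulf_neq0 // invr_eq0 mulf_neq0 ?expf_neq0.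
have c0M : x / xs \in M.
  have -> : x / xs = (x * y ^+ 1) * (x ^+ 2 * ((1 + z) / g)).
    by rewrite /xs yE; field; rewrite x0 y0 g0 z10.
  by rewrite infMr // rpredM ?rpredX ?(inf_int xM) // rpredM.
pose c := e * (1 + z) * x / g.
have cM : c \in M by rewrite /c infMr // infMl // rpredM.
(* The equation for u = x' / xs, divided by g * xs. *)
have [||u uE uM] := @hensel_cubic K v (- (x / xs)) (-1 - c) 1 0 1.
- have -> : - (x / xs) + (-1 - c) * 1 + 1 * 1 ^+ 2 + 0 * 1 ^+ 3 = - (x / xs) - c by ring.
  by rewrite rpredB ?rpredN.
- rewrite (inf_eqv (b := 1)) ?one_notinf //.
  have -> : -1 - c + 2%:R * 1 * 1 + 3%:R * 0 * 1 ^+ 2 - 1 = - c by ring.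
  by rewrite rpredN.
have uU := int_unit1 uM; have u0 := notinf_neq0 uU.
exists (xs * u).
  apply: horiz_quadratic => //; first by rewrite mulf_neq0.
  apply/eqP; rewrite -subr_eq0.
  rewrite (_ : _ - _ = g * xs * (- (x / xs) + (-1 - c) * u + 1 * u ^+ 2 + 0 * u ^+ 3)).
    by rewrite uE mulr0.
  by rewrite /c /xs -!exprVn -/z -/g; field; rewrite x0 g0 y1.
split=> //; first by rewrite mulf_neq0.
move=> n; have -> : (xs * u)^-1 * y ^+ n = (x * y ^+ n.+1) * (x * ((1 + z) / (g * u))).
  by rewrite /xs yE [y ^+ n.+1]exprS; move: (y ^+ n) => Y; field; rewrite x0 y0 g0 z10 u0.
by rewrite infMr // rpredM ?(inf_int xM) // rpredM // intV // notinfM.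
Qed.

(** Go horizontally to a small x3, where x^-2 (1 + y^-2) dominates, a function
    of y^2; so y can be changed into -y up to M.  Then climb back to large x. *)
Lemma far_reflect x y : far x y ->
  exists u : K * K, [/\ reach S (x, y) u, far u.1 u.2 & u.2 + y \in M].
Proof.
case=> x0 y0 zM xyM; pose z := y^-1; pose g := 1 + z ^+ 2.
have xVM : x^-1 \in M by have := xyM 0%N; rewrite mulr1.
have z2M : z ^+ 2 \in M by exact: inf_exp.
have gU := inf_unit z2M; have g0 := inf_unit_neq0 z2M; rewrite -/g in gU g0.
have gV := intV gU; have gO : g \in O by rewrite rpredD ?rpred1 // inf_int.
have z1 := inf_unit zM; have z10 := inf_unit_neq0 zM; rewrite -/z in z1 z10.
have z1O : 1 + z \in O by rewrite rpredD ?rpred1 // inf_int.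
have yE : 1 + y = y * (1 + z) by rewrite /z; field.
have y1 : 1 + y != 0 by rewrite yE mulf_neq0.
have [xs xsE] := closed_root (g / ((1 + y) * x)) (isT : 0 < 2)%N.
have xs0 : xs != 0.
  apply: contra_eq_neq xsE => ->; rewrite expr0n eq_sym.
  by rewrite mulf_neq0 // invr_eq0 mulf_neq0.
have xsM n : xs * y ^+ n \in M.
  apply: (@inf_root _ _ _ 2).
  have -> : (xs * y ^+ n) ^+ 2 = (x^-1 * y ^+ (n * 2)) * (y^-1 * (g / (1 + z))).
    rewrite exprMn xsE yE [in RHS]exprM; move: (y ^+ n) => Y.
    by field; rewrite x0 y0 z10.
  by apply: infMr => //; apply: inf_int; apply: infMr => //; rewrite rpredM // intV.
have xsM0 : xs \in M by have := xsM 0%N; rewrite mulr1.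
pose c := xs / x + e * (1 + z) / g * xs.
have cM : c \in M.
  by rewrite rpredD //; [rewrite infMinf|rewrite infMl // rpredM // rpredM].
have [||Z ZE ZM] := @hensel_cubic K v (-1) (- c) 1 0 1.
- have -> : -1 + - c * 1 + 1 * 1 ^+ 2 + 0 * 1 ^+ 3 = - c by ring.
  by rewrite rpredN.
- rewrite (inf_eqv (b := 2%:R)) ?natr_notinf //.
  have -> : - c + 2%:R * 1 * 1 + 3%:R * 0 * 1 ^+ 2 - 2%:R = - c by ring.
  by rewrite rpredN.
have ZU := int_unit1 ZM; have Z0 := notinf_neq0 ZU; have ZO := int_near1 ZM.
pose x3 := xs * Z.
have x30 : x3 != 0 by rewrite mulf_neq0.
have r1 : reach S (x, y) (x3, y).
  apply: horiz_quadratic => //; apply/eqP; rewrite -subr_eq0.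
  have -> : (1 + y) * x ^+ 2 * x3 ^+ 2 = g * x * Z ^+ 2.
    by rewrite /x3 exprMn xsE; field; rewrite x0 y1.
  rewrite (_ : _ - _ = g * x * (-1 + - c * Z + 1 * Z ^+ 2 + 0 * Z ^+ 3)).
    by rewrite ZE mulr0.
  by rewrite /c /x3 -!exprVn -/z -/g; field; rewrite x0 g0.
have x3M n : x3 * y ^+ n \in M by rewrite /x3 mulrAC infMr.
(* With y' = - y * (1 + mu * z), the vertical equation is quadratic in mu. *)
pose p := x3 ^+ 3 * y ^+ 4; pose q := e * (x3 * y ^+ 2).
have qM : q \in M by rewrite infMl.
have pM : p \in M.
  have -> : p = (x3 * y ^+ 2) ^+ 2 * (x3 * y ^+ 0) by rewrite /p; ring.
  by apply: infMinf; [apply: inf_exp => //; exact: x3M|exact: x3M].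
have [||mu muE muM] := @hensel_cubic K v (p + q) (1 + 2%:R * z * p + q * z) (z ^+ 2 * p) 0 0.
- by rewrite !expr0n /= mul0r !mulr0 !addr0 rpredD.
- rewrite (inf_eqv (b := 1)) ?one_notinf //.
  have -> : 1 + 2%:R * z * p + q * z + 2%:R * (z ^+ 2 * p) * 0 + 3%:R * 0 * 0 ^+ 2 - 1 =
     2%:R * (z * p) + q * z by ring.
  by apply: rpredD; [apply: infMl; rewrite ?rpred_nat // infMinf|exact: infMinf].
rewrite subr0 in muM.
pose u := 1 + mu * z.
have muzM : mu * z \in M by rewrite infMinf.
have uU := inf_unit muzM; have u0 := inf_unit_neq0 muzM; rewrite -/u in uU u0.
have uO : u \in O by rewrite rpredD ?rpred1 // inf_int.
pose y' := - y * u.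
have y'0 : y' != 0 by rewrite mulf_neq0 ?oppr_eq0.
have r2 : reach S (x3, y) (x3, y').
  apply: vert_quadratic => //; apply/eqP; rewrite -subr_eq0.
  rewrite (_ : _ - _ = (p + q) + (1 + 2%:R * z * p + q * z) * mu + (z ^+ 2 * p) * mu ^+ 2 + 0 * mu ^+ 3).
    by rewrite muE.
  by rewrite /y' /u /p /q /z; field.
have y'V : y'^-1 \in M.
  have -> : y'^-1 = - (z / u) by rewrite /y' invfM invrN mulNr.
  by rewrite rpredN infMr // intV.
have x3y' n : x3 * y' ^+ n \in M.
  have -> : x3 * y' ^+ n = x3 * y ^+ n * (- u) ^+ n by rewrite /y' mulNr -mulrN exprMn mulrA.
  by rewrite infMr // rpredX // rpredN.
have [x4 r3 far4] := climb x30 y'0 y'V x3y'.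
exists (x4, y'); split=> //; first exact: (reach_trans r1 (reach_trans r2 r3)).
have -> : (x4, y').2 + y = - mu by rewrite /= /y' /u /z; field.
by rewrite rpredN.
Qed.

(** Go vertically to a small y1, with y1^2 close to 1 / (x^3 y).  There S is close
    to x + x^-2 y1^-2, and with xi = x1 / x the horizontal equation becomes
    xi^2 = y (1 + xi), which has a root xi = -1 + nu / y with nu close to 1.  The
    vertical equation at x1 then gives y2 close to y / xi^3, that is
    -y (1 + 3 / y) up to M.  Both nu and mu = -(y2 + y) are found by Hensel's
    lemma, the second one near 3. *)
Lemma far_shift x y : far x y ->
  exists u : K * K, [/\ reach S (x, y) u, far u.1 u.2 & u.2 + y + 3%:R \in M].
Proof.
case=> x0 y0 zM xyM; pose z := y^-1.
have xVM : x^-1 \in M by have := xyM 0%N; rewrite mulr1.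
have zO := inf_int zM.
have [ys ysE] := closed_root (x ^+ 3 * y)^-1 (isT : 0 < 2)%N.
have ys0 : ys != 0.
  apply: contra_eq_neq ysE => ->; rewrite expr0n eq_sym.
  by rewrite invr_eq0 mulf_neq0 ?expf_neq0.
(* d ^+ 2 = y / x, so that even x * y * y1 is small. *)
pose d := ys * x * y.
have dM : d \in M.
  apply: (@inf_root _ _ _ 2); have := xyM 1%N.
  by rewrite /d !exprMn ysE; congr (_ \in M); field; rewrite x0 y0.
have ysM : ys \in M.
  have -> : ys = d * (x^-1 * y^-1) by rewrite /d; field; rewrite x0 y0.
  by rewrite infMinf // infMinf.
pose eta := ys + e * d.
have etaM : eta \in M by rewrite rpredD // infMl.
pose eps := eta * z.
have epsM : eps \in M by rewrite infMinf.
have [||Z ZE ZM] := @hensel_cubic K v (-1) (- eps) 1 0 1.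
- have -> : -1 + - eps * 1 + 1 * 1 ^+ 2 + 0 * 1 ^+ 3 = - eps by ring.
  by rewrite rpredN.
- rewrite (inf_eqv (b := 2%:R)) ?natr_notinf //.
  have -> : - eps + 2%:R * 1 * 1 + 3%:R * 0 * 1 ^+ 2 - 2%:R = - eps by ring.
  by rewrite rpredN.
have ZU := int_unit1 ZM; have Z0 := notinf_neq0 ZU; have ZO := int_near1 ZM.
have Z2E : Z ^+ 2 = 1 + eps * Z.
  by apply/eqP; rewrite -subr_eq0; apply/eqP; rewrite -[RHS]ZE; ring.
pose y1 := ys * Z.
have y10 : y1 != 0 by rewrite mulf_neq0.
have y1M : y1 \in M by rewrite infMr.
have y1O := inf_int y1M.
have y1sq : x ^+ 3 * y1 ^+ 2 = Z ^+ 2 * z.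
  by rewrite /y1 exprMn ysE /z; field; rewrite x0 y0.
have r1 : reach S (x, y) (x, y1).
  apply: vert_quadratic => //.
  have -> : x ^+ 3 * y ^+ 2 * y1 ^+ 2 = Z ^+ 2 * y.
    by rewrite mulrAC y1sq /z; field.
  by rewrite Z2E /eps /eta /d /y1 /z; field.
(* With x1 = x * (-1 + nu * z), the horizontal equation is quadratic in nu. *)
pose k := e * (d * Z * (1 + y1)).
have kM : k \in M by rewrite infMl // infMr ?rpredD ?rpred1 // infMr.
pose b := Z ^+ 2 * (1 + y1).
have bM : b - 1 \in M.
  by rewrite /b near1M ?inf_near1 // (near1_expz 2).
have bO := int_near1 bM.
have [||nu nuE nuM] := @hensel_cubic K v (- k - b)
    (1 + y1 ^+ 2 + (k + 2%:R * b) * z) (- (b * z ^+ 2)) 0 1.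
- have -> : - k - b + (1 + y1 ^+ 2 + (k + 2%:R * b) * z) * 1 + - (b * z ^+ 2) * 1 ^+ 2 +
    0 * 1 ^+ 3 = - k - (b - 1) + y1 * y1 + (k + 2%:R * b - b * z) * z by ring.
  apply: rpredD; last apply: infMl => //.
    by apply: rpredD; [rewrite rpredB ?rpredN|exact: infMinf].
  by solve_integral.
- rewrite (inf_eqv (b := 1)) ?one_notinf //.
  have -> : 1 + y1 ^+ 2 + (k + 2%:R * b) * z + 2%:R * - (b * z ^+ 2) * 1 +
     3%:R * 0 * 1 ^+ 2 - 1 = y1 * y1 + (k + 2%:R * b - 2%:R * (b * z)) * z by ring.
  apply: rpredD; first by rewrite infMinf.
  by apply: infMl => //; solve_integral.
have nuO := int_near1 nuM.
pose xi := - (1 - nu * z).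
have nzM : nu * z \in M by rewrite infMl.
have xiU : xi \notin M.
  by rewrite /xi rpredN; apply: inf_unit; rewrite rpredN.
have xi0 := notinf_neq0 xiU.
have xiO : xi \in O by rewrite rpredN rpredB ?rpred1 // inf_int.
pose x1 := xi * x.
have x10 : x1 != 0 by rewrite mulf_neq0.
have r2 : reach S (x, y1) (x1, y1).
  apply: horiz_quadratic => //.
  apply: (mulIf (expf_neq0 2 y10)); apply: (mulIf (invr_neq0 x0)).
  have -> : (1 + y1) * x ^+ 2 * x1 ^+ 2 * y1 ^+ 2 / x = (1 + y1) * xi ^+ 2 * (Z ^+ 2 * z).
    by rewrite -y1sq /x1; field.
  apply: (mulIf y0); apply/eqP; rewrite -subr_eq0; apply/eqP.
  rewrite -[RHS]oppr0 -[in RHS]nuE /k /b /x1 /xi /z /d /y1; field.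
  by rewrite x0 y0 ys0 Z0.
(* With y2 = - y * (1 + mu * z), the vertical equation, divided by z, is quadratic
   in mu.  Its constant term contains (c - 1) / z, which is expanded to see its
   residue. *)
pose l := e * (xi * (d * Z)).
have lM : l \in M by rewrite infMl // infMl // infMr.
pose kap := (1 - nu * z) ^+ 3.
have kapM : kap - 1 \in M.
  by rewrite /kap (near1_expz 3) // inf_near1 // rpredN.
have kapO := int_near1 kapM.
pose c := Z ^+ 2 * kap.
have cM : c - 1 \in M by rewrite near1M // (near1_expz 2).
have cO := int_near1 cM.
pose c0 := eta * Z * kap + (- 3%:R * nu + 3%:R * nu ^+ 2 * z - nu ^+ 3 * z ^+ 2) + y1 - l.
have c0M : c0 + 3%:R \in M.
  have -> : c0 + 3%:R = eta * (Z * kap) - 3%:R * (nu - 1) +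
      (3%:R * nu ^+ 2 - nu ^+ 3 * z) * z + y1 - l by rewrite /c0; ring.
  apply: rpredB => //; apply: rpredD => //; apply: rpredD; last first.
    by apply: infMl => //; solve_integral.
  apply: rpredB; first by rewrite infMr // rpredM.
  by apply: infMl; rewrite ?rpred_nat.
have [||mu muE muM] := @hensel_cubic K v c0 (2%:R * c - 1 - l * z) (c * z) 0 3%:R.
- have -> : c0 + (2%:R * c - 1 - l * z) * 3%:R + c * z * 3%:R ^+ 2 + 0 * 3%:R ^+ 3 =
    c0 + 3%:R + 6%:R * (c - 1) + (9%:R * c - 3%:R * l) * z by ring.
  apply: rpredD; last first.
    by apply: infMl => //; solve_integral.
  by apply: rpredD => //; rewrite infMl ?rpred_nat.
- rewrite (inf_eqv (b := 1)) ?one_notinf //.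
  have -> : 2%:R * c - 1 - l * z + 2%:R * (c * z) * 3%:R + 3%:R * 0 * 3%:R ^+ 2 - 1 =
    2%:R * (c - 1) + (6%:R * c - l) * z by ring.
  apply: rpredD; first by rewrite infMl ?rpred_nat.
  by apply: infMl => //; solve_integral.
have muO : mu \in O by apply: int_eqv muM _; rewrite rpred_nat.
pose u := 1 + mu * z.
have muzM : mu * z \in M by rewrite infMl.
have uU := inf_unit muzM; have u0 := inf_unit_neq0 muzM; rewrite -/u in uU u0.
have uO : u \in O by rewrite rpredD ?rpred1 // inf_int.
pose y2 := - y * u.
have y20 : y2 != 0 by rewrite mulf_neq0 ?oppr_eq0.
have r3 : reach S (x1, y1) (x1, y2).
  apply: vert_quadratic => //.
  have -> : x1 ^+ 3 * y1 ^+ 2 * y2 ^+ 2 = - (c * y * u ^+ 2).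
    have -> : x1 ^+ 3 * y1 ^+ 2 = xi ^+ 3 * (x ^+ 3 * y1 ^+ 2) by rewrite /x1; ring.
    by rewrite y1sq /y2 /c /kap /xi /z; field.
  have c0E : c0 = (c - 1) * y + y1 - l.
    by rewrite /c0 /c Z2E /eps /kap /z; field.
  have lE : e * x1 * y1 = l * z by rewrite /l /d /x1 /y1 /z; field.
  apply/eqP; rewrite -subr_eq0; apply/eqP; rewrite -[RHS]oppr0 -[in RHS]muE c0E lE.
  by rewrite /y2 /u /z; field.
have y2V : y2^-1 \in M.
  have -> : y2^-1 = - (z / u) by rewrite /y2 invfM invrN mulNr.
  by rewrite rpredN infMr // intV.
exists (x1, y2); split.
- exact: (reach_trans r1 (reach_trans r2 r3)).
- split=> //= n; have -> : x1^-1 * y2 ^+ n = (x^-1 * y ^+ n) * (xi^-1 * (- u) ^+ n).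
    rewrite /y2 mulNr -mulrN exprMn /x1 invfM; ring.
  by rewrite infMr // rpredM ?intV // rpredX // rpredN.
- have -> : (x1, y2).2 + y + 3%:R = - (mu - 3%:R) by rewrite /= /y2 /u /z; field.
  by rewrite rpredN.
Qed.

Lemma translation_infinite x y : far x y ->
  infinite_set [set u | reach S (x, y) u]%classic.
Proof.
move=> farxy.
pose I (n : nat) (u : K * K) := u.2 - y - n%:R * 3%:R \in M.
apply: (@infinite_indexed _ _ I); last exact: progression_inj (natr_notinf v 2).
suff QI n : exists2 u, reach S (x, y) u /\ far u.1 u.2 & I n u.
  by move=> n; have [u [ru _] Iu] := QI n; exists u.
elim: n => [|n [[x1 y1] [/= r1 far1] I1]].
  by exists (x, y); [split=> //; exact: reach_refl|rewrite /I /= subrr mul0r subrr rpred0].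
have [[x2 y2] /= [r2 far2 y2M]] := far_shift far1.
have [[x3 y3] /= [r3 far3 y3M]] := far_reflect far2.
exists (x3, y3); first by split=> //; exact: (reach_trans r1 (reach_trans r2 r3)).
rewrite /I /= in I1 *.
have := rpredD I1 (rpredB y3M y2M); congr (_ \in M).
by rewrite -natr1; ring.
Qed.
End Translation.

(** * Inverting the second coordinate *)

Definition mirror (S : {fset int * int}) : {fset int * int} :=
  [fset (s.1, - s.2) | s in S]%fset.

Lemma mem_mirror S i j : ((i, j) \in mirror S) = ((i, - j) \in S).
Proof.
apply/imfsetP/idP => [[[k l] /= klS [-> ->]]|ijS]; first by rewrite opprK.
by exists (i, - j); rewrite //= opprK.
Qed.

Lemma step_poly_mirror (K : fieldType) (S : {fset int * int}) (u : K * K) :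
  step_poly (mirror S) u = step_poly S (u.1, u.2^-1).
Proof.
rewrite /step_poly big_imfset /=; last by move=> [i j] [k l] _ _ /= [-> /oppr_inj->].
by apply: eq_bigr => s _; rewrite exprz_inv.
Qed.

Lemma infinite_mirror (K : fieldType) (S : {fset int * int}) (x y : K) :
  infinite_set [set u | reach (mirror S) (x, y^-1) u]%classic ->
  infinite_set [set u | reach S (x, y) u]%classic.
Proof.
pose f (u : K * K) := (u.1, u.2^-1).
have fK : involutive f by case=> a b; rewrite /f /= invrK.
move=> infm fin; apply: infm; have fI := inv_inj fK.
have : finite_set (f @^-1` [set u | reach S (x, y) u])%classic.
  by apply: finite_preimage fin => u w _ _; exact: fI.
apply: sub_finite_set => u /= xyu.
have -> : (x, y) = f (x, y^-1) by rewrite /f /= invrK.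
elim: xyu => [u1 u2 [/and4P[h1 h2 h3 h4] ne E dif]|u1|u1 u2 u3 _ r12 _ r23].
- apply: rt_step; split; rewrite /f /= ?invr_eq0 ?h1 ?h2 ?h3 ?h4 //.
  + by rewrite (inj_eq fI).
  + by rewrite -!step_poly_mirror.
  + by rewrite (inj_eq invr_inj).
- exact: reach_refl.
- exact: reach_trans r12 r23.
Qed.

Lemma step_poly_seq (K : fieldType) (S : {fset int * int}) (l : seq (int * int)) (u : K * K) :
  uniq l -> S =i l -> step_poly S u = \sum_(s <- l) u.1 ^ s.1 * u.2 ^ s.2.
Proof. by move=> ul Sl; apply: perm_big; apply: uniq_perm. Qed.

(** * The generic point *)

Section Main.
Variables (R : realType) (K : closedFieldType) (iota : {rmorphism ratfun2 R -> K}).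
Let psi : {rmorphism {poly {poly R[i]}} -> K} := iota \o @tofrac _.
Let psi' : {rmorphism {poly {poly R[i]}} -> K} := psi \o swapXY.
Let x := iota (varx R).
Let y := iota (vary R).

Lemma psi_inj : injective psi.
Proof. by move=> p q /fmorph_inj /eqP; rewrite tofrac_eq => /eqP. Qed.

Lemma char_complex n : n.+1%:R != 0 :> R[i].
Proof. by rewrite pnatr_eq0. Qed.

Lemma place_x : exists v : place K, x \in infinitesimal v /\
  forall q : {poly R[i]}, q != 0 -> psi q%:P \in integral v /\ psi q%:P \notin infinitesimal v.
Proof. exact: place_small psi_inj char_complex. Qed.

(** The same with the variables exchanged: y is small and polynomials in x alone
    are units. *)
Lemma place_y : exists v : place K, y \in infinitesimal v /\
  forall q : {poly R[i]}, q != 0 -> psi' q%:P \in integral v /\ psi' q%:P \notin infinitesimal v.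
Proof.
have psi'I : injective psi' by move=> p q /psi_inj /(can_inj swapXYK).
have [v [vM vq]] := place_small psi'I char_complex; exists v; split=> //.
by move: vM; rewrite /psi' /= swapXY_X.
Qed.

Lemma x_neq0 : x != 0.
Proof. by rewrite fmorph_eq0 tofrac_eq0 polyX_eq0. Qed.

Lemma y_neq0 : y != 0.
Proof. by rewrite fmorph_eq0 tofrac_eq0 polyC_eq0 polyX_eq0. Qed.

Lemma place_x_monomials : exists v : place K, [/\ x \in infinitesimal v,
  forall (i j : nat), (0 < i)%N -> mono x y i (- j%:Z) \in infinitesimal v &
  forall (i j : nat), (0 < i)%N -> mono x y^-1 i (- j%:Z) \in infinitesimal v].
Proof.
have [v [xM vq]] := place_x; exists v.
have [yO yM] : y \in integral v /\ y \notin infinitesimal v.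
  by apply: vq; rewrite polyX_eq0.
split=> // i j i0; rewrite /mono infMr ?(inf_exp i0 xM) //.
  by rewrite -exprnN -exprVn rpredX // intV.
by rewrite -exprnN -exprVn invrK rpredX.
Qed.

(** The start x small, y a unit is in the region where the monomial (-m, p)
    dominates, and so is its mirror image. *)
Lemma vertex_orbit (S : {fset int * int}) (m p k n v1 v2 : nat) :
    (0 < m)%N -> (0 < p)%N -> (0 < k)%N -> (0 < n)%N -> (0 < v1)%N -> (0 < v2)%N ->
    (v2 * (p + n) = v1 * (k + m))%N ->
    (- m%:Z, p%:Z) \in S -> (k%:Z, - n%:Z) \in S ->
    (forall s : int * int, s \in S -> [/\ s.1 <= k%:Z, s.2 <= p%:Z &
       0 <= v1%:Z * (s.1 + m%:Z) + v2%:Z * (s.2 - p%:Z)]) ->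
  infinite_set [set u | reach S (x, y) u]%classic /\
  infinite_set [set u | reach S (x, y^-1) u]%classic.
Proof.
move=> m0 p0 k0 n0 v10 v20 hv aS bS hS; have [v [xM h1 h2]] := place_x_monomials.
have x0 := x_neq0; have y0 := y_neq0.
by split; apply: (contracting_vertex m0 p0 k0 n0 v10 v20 hv aS bS hS x0 _ xM);
  rewrite ?invr_eq0 // ?h1 ?h2.
Qed.

(** With y small and x a unit, (1, -2) dominates; one horizontal move leads into
    the loop. *)
Lemma cycle_orbit (S : {fset int * int}) :
    S = [fset (-2, -1); (-1, 1); (0, 1); (1, -2); (1, 0); (1, 1)]%fset%Z ->
  infinite_set [set u | reach S (x, y) u]%classic.
Proof.
move=> SE; have [v [yM vq]] := place_y; have x0 := x_neq0; have y0 := y_neq0.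
have [xO xM] : x \in integral v /\ x \notin infinitesimal v.
  by have := vq 'X; rewrite polyX_eq0 /= swapXY_polyC map_polyX; apply.
have xeO i : x ^ i \in integral v.
  case: i => n; first exact: rpredX.
  by rewrite NegzE -exprnN -exprVn rpredX // intV.
have mM (i j : int) : 0 < j -> mono x y i j \in infinitesimal v.
  by case: j => // j j0; rewrite /mono infMl // (inf_exp _ yM).
have aS : ((1, -2) : int * int) \in S by rewrite SE !inE.
have bS : ((-2, -1) : int * int) \in S by rewrite SE !inE.
have [|||||x' [x'0 r [w wM wE]]] :=
  @horiz_move K v S (1, -2) (-2, -1) x y (-1) 1 x0 y0 aS bS.
- by [].
- by move=> [i j]; rewrite SE !inE !xpair_eqE /= => h1 h2; apply: mM; lia.
- by [].
- by [].
- by move=> [i j]; rewrite SE !inE !xpair_eqE /= => h1 h2; apply: mM; lia.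
rewrite /= in wE.
apply: (infinite_reach r); apply: (@contracting_cycle K v _ _ _ SE) => //.
  by apply: (mono_transferl y0 wE wM); exact: mM.
by apply: (mono_transferl y0 wE wM); exact: mM.
Qed.

Lemma translation_orbit (S : {fset int * int}) (e : K) :
    e \in [:: 0; 1] ->
    (forall a b : K, a != 0 -> b != 0 -> step_poly S (a, b) =
      a * (1 + b) + a^-2 * (1 + b^-2) + e * a^-1 * (1 + b^-1)) ->
  infinite_set [set u | reach S (x, y) u]%classic.
Proof.
move=> e01 hS; have [v [xM vq]] := place_x; have x0 := x_neq0; have y0 := y_neq0.
pose psiY : {rmorphism {poly R[i]} -> K} := psi \o polyC.
have [w [vw yV]] := @place_refine _ _ psiY v char_complex vq.
have eO : e \in integral w.
  by move: e01; rewrite !inE => /orP[] /eqP ->; rewrite ?rpred0 ?rpred1.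
have yO : y \in integral v by have [] := vq 'X; rewrite ?polyX_eq0.
have xyM n : x * y ^+ n \in infinitesimal w by apply: vw; rewrite infMr ?rpredX.
have [x' r far'] := climb eO hS x0 y0 yV xyM.
by apply: (infinite_reach r); exact: (translation_infinite eO hS far').
Qed.

(** Starting with y small, one vertical move makes y large; the mirror image
    starts there. *)
Lemma drift_orbit (S : {fset int * int}) :
    (forall a b : K, a != 0 -> b != 0 ->
      step_poly S (a, b) = (1 + a) * (b + b^-1 * (1 + a^-2))) ->
  infinite_set [set u | reach S (x, y) u]%classic /\
  infinite_set [set u | reach S (x, y^-1) u]%classic.
Proof.
move=> hS; have [v [yM vq]] := place_y; have x0 := x_neq0; have y0 := y_neq0.
have unit_psi (q : {poly R[i]}) : q != 0 -> psi q^:P \in integral v /\ psi q^:P \notin infinitesimal v.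
  by move=> /vq; rewrite /= swapXY_polyC.
have [xO xM] : x \in integral v /\ x \notin infinitesimal v.
  by have := unit_psi 'X; rewrite polyX_eq0 /= map_polyX; apply.
have x1M : 1 + x \notin infinitesimal v.
  have -> : 1 + x = psi ('X + 1%:P)^:P.
    by rewrite polyC1 !rmorphD !rmorph1 addrC /= map_polyX.
  by apply: (unit_psi ('X + 1%:P) _).2; rewrite -size_poly_eq0 size_XaddC.
have x2M : 1 + x ^+ 2 \notin infinitesimal v.
  have -> : 1 + x ^+ 2 = psi ('X^2 + 1%:P)^:P.
    by rewrite polyC1 !rmorphD !rmorph1 addrC !rmorphXn /= map_polyX.
  by apply: (unit_psi ('X^2 + 1%:P) _).2; rewrite -size_poly_eq0 size_XnaddC.
have yVM : y^-1^-1 \in infinitesimal v by rewrite invrK.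
have yV0 : y^-1 != 0 by rewrite invr_eq0.
split; last exact: (drift_infinite hS xO xM x1M yV0 yVM).
pose y1 := (1 + x^-2) / y.
have DE : 1 + x^-2 = (1 + x ^+ 2) / x ^+ 2 by field.
have D0 : 1 + x^-2 != 0.
  by rewrite DE mulf_neq0 ?invr_eq0 ?expf_neq0 // (notinf_neq0 x2M).
have y10 : y1 != 0 by rewrite mulf_neq0 ?invr_eq0.
have y1V : y1^-1 \in infinitesimal v.
  have -> : y1^-1 = y * (x ^+ 2 / (1 + x ^+ 2)).
    by rewrite /y1 DE !invf_div.
  by rewrite infMr // rpredM ?rpredX // intV.
apply: (@infinite_reach _ _ _ (x, y1)); last exact: (drift_infinite hS xO xM x1M y10 y1V).
apply: reach_vert => //; rewrite !hS // /y1.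
by move: D0; set D := 1 + x ^- 2 => D0; field; rewrite D0 y0.
Qed.
End Main.

(** * The sixteen step sets *)

Theorem proposition23 (R : realType) (K : closedFieldType)
  (iota : {rmorphism ratfun2 R -> K}) (hK : algebraic_closure iota)
  (S : {fset int * int}) (hS : S \in exceptional_step_sets) :
  infinite_set (step_orbit iota S).
Proof.
rewrite /step_orbit -/(reach S _).
pose x := iota (varx R); pose y := iota (vary R).
(* The corner (-2, 1), (1, -2), with vertex in the direction (1, 1). *)
have vertex11 S' : (-2, 1) \in S' -> (1, -2) \in S' ->
    (forall s : int * int, s \in S' -> [/\ s.1 <= 1, s.2 <= 1 &
       0 <= 1 * (s.1 + 2) + 1 * (s.2 - 1)]) ->
    infinite_set [set u | reach S' (x, y) u]%classic.
  by move=> a b c; apply: (@vertex_orbit R K iota S' 2 1 1 2 1 1 _ _ _ _ _ _ _ a b c).1.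
(* The corner (-2, 1), (1, -1), with vertex in the direction (2, 3); its mirror image
   is the corner (-2, -1), (1, 1). *)
have vertex23 S' : (-2, 1) \in S' -> (1, -1) \in S' ->
    (forall s : int * int, s \in S' -> [/\ s.1 <= 1, s.2 <= 1 &
       0 <= 2 * (s.1 + 2) + 3 * (s.2 - 1)]) ->
    infinite_set [set u | reach S' (x, y) u]%classic /\
    infinite_set [set u | reach S' (x, y^-1) u]%classic.
  by move=> a b c; apply: (@vertex_orbit R K iota S' 2 1 1 1 2 3 _ _ _ _ _ _ _ a b c).
have vertex23_mirror S' : (-2, -1) \in S' -> (1, 1) \in S' ->
    (forall s : int * int, s \in S' -> [/\ s.1 <= 1, -1 <= s.2 &
       0 <= 2 * (s.1 + 2) + 3 * (- s.2 - 1)]) ->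
    infinite_set [set u | reach S' (x, y) u]%classic.
  move=> a b c; apply: infinite_mirror; apply: (vertex23 (mirror S') _ _ _).2.
  - by rewrite mem_mirror.
  - by rewrite mem_mirror.
  - by move=> [i j]; rewrite mem_mirror => /c[/= h1 h2 h3]; split => //=; lia.
have exprN2 (a : K) : a ^ (-2)%Z = a ^- 2 by [].
move: hS; rewrite /exceptional_step_sets !inE.
do 15?[case/orP]; move=> /eqP SE.
- rewrite SE; apply: vertex11; rewrite ?inE //.
  by move=> [i j]; rewrite !inE !xpair_eqE /= => h; split; lia.
- rewrite SE; apply: vertex11; rewrite ?inE //.
  by move=> [i j]; rewrite !inE !xpair_eqE /= => h; split; lia.
- rewrite SE; apply: (vertex23 _ _ _ _).1; rewrite ?inE //.
  by move=> [i j]; rewrite !inE !xpair_eqE /= => h; split; lia.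
- rewrite SE; apply: (vertex23 _ _ _ _).1; rewrite ?inE //.
  by move=> [i j]; rewrite !inE !xpair_eqE /= => h; split; lia.
- rewrite SE; apply: vertex23_mirror; rewrite ?inE //.
  by move=> [i j]; rewrite !inE !xpair_eqE /= => h; split; lia.
- rewrite SE; apply: vertex23_mirror; rewrite ?inE //.
  by move=> [i j]; rewrite !inE !xpair_eqE /= => h; split; lia.
- rewrite SE; apply: (vertex23 _ _ _ _).1; rewrite ?inE //.
  by move=> [i j]; rewrite !inE !xpair_eqE /= => h; split; lia.
- rewrite SE; apply: vertex23_mirror; rewrite ?inE //.
  by move=> [i j]; rewrite !inE !xpair_eqE /= => h; split; lia.
- apply: (@translation_orbit R K iota S 0); first by rewrite !inE eqxx ?orbT.
  move=> a b a0 b0; rewrite (@step_poly_seq K S [:: (-2, -2); (-2, 0); (1, 0); (1, 1)]%Z) //; last first.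
    by move=> s; rewrite SE !inE -!orbA.
  rewrite !big_cons big_nil /= !(exprN2, exprN1, expr1z, expr0z).
  by field; rewrite a0 b0.
- apply: (@translation_orbit R K iota S 1); first by rewrite !inE eqxx ?orbT.
  move=> a b a0 b0; rewrite (@step_poly_seq K S [:: (-2, -2); (-2, 0); (-1, -1); (-1, 0); (1, 0); (1, 1)]%Z) //; last first.
    by move=> s; rewrite SE !inE -!orbA.
  rewrite !big_cons big_nil /= !(exprN2, exprN1, expr1z, expr0z).
  by field; rewrite a0 b0.
- apply: (@drift_orbit R K iota S _).1 => a b a0 b0.
  rewrite (@step_poly_seq K S [:: (-2, -1); (-1, -1); (0, -1); (0, 1); (1, -1); (1, 1)]%Z) //; last first.
    by move=> s; rewrite SE !inE -!orbA.
  rewrite !big_cons big_nil /= !(exprN2, exprN1, expr1z, expr0z).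
  by field; rewrite a0 b0.
- apply: infinite_mirror; apply: (@drift_orbit R K iota (mirror S) _).2 => a b a0 b0.
  rewrite step_poly_mirror.
  rewrite (@step_poly_seq K S [:: (-2, 1); (-1, 1); (0, -1); (0, 1); (1, -1); (1, 1)]%Z) //; last first.
    by move=> s; rewrite SE !inE -!orbA.
  rewrite !big_cons big_nil /= !(exprN2, exprN1, expr1z, expr0z).
  by rewrite ?invrK; field; rewrite a0 b0.
- rewrite SE; apply: vertex11; rewrite ?inE //.
  by move=> [i j]; rewrite !inE !xpair_eqE /= => h; split; lia.
- rewrite SE; apply: vertex11; rewrite ?inE //.
  by move=> [i j]; rewrite !inE !xpair_eqE /= => h; split; lia.
- exact: cycle_orbit SE.
- rewrite SE; apply: vertex11; rewrite ?inE //.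
  by move=> [i j]; rewrite !inE !xpair_eqE /= => h; split; lia.
Qed.
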